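(* Let $\mathfrak g$ and $V$ be vector spaces, and let $L'$, $\mathfrak h$, $P$ and $[\cdot,\cdot]_{\mathsf B}$ be as in the context. Then $(s^{-1}L'\oplus\mathfrak h,\{l_i\}_{i\ge1})$ is an $L_\infty$-algebra, where $$l_2(s^{-1}Q,s^{-1}Q')=(-1)^{|Q|}s^{-1}[Q,Q']_{\mathsf B},\qquad l_k(s^{-1}Q,\theta_1,\dots,\theta_{k-1})=P[\cdots[[Q,\theta_1]_{\mathsf B},\theta_2]_{\mathsf B},\cdots,\theta_{k-1}]_{\mathsf B}\quad(k\ge2),$$ for homogeneous $\theta_1,\dots,\theta_{k-1}\in\mathfrak h$ and homogeneous $Q,Q'\in L'$ ($|Q|$ the degree of $Q$ in $L'$), and all other possible combinations (not obtained from these by permuting arguments according to graded symmetry) vanish.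
   Context: Vector spaces are over a field of characteristic $0$. Balavoine bracket: for a vector space $E$ let $C^n(E,E)=\mathrm{Hom}(\otimes^{n+1}E,E)$, $n\ge0$. For $P'\in C^p(E,E)$, $Q\in C^q(E,E)$: $[P',Q]_{\mathsf B}=P'\bar\circ Q-(-1)^{pq}Q\bar\circ P'$, $P'\bar\circ Q=\sum_{k=1}^{p+1}P'\circ_kQ$, $$(P'\circ_kQ)(x_1,\dots,x_{p+q+1})=\sum_{\sigma\in\mathbb S_{(k-1,q)}}(-1)^{(k-1)q}(-1)^\sigma P'\big(x_{\sigma(1)},\dots,x_{\sigma(k-1)},Q(x_{\sigma(k)},\dots,x_{\sigma(k+q-1)},x_{k+q}),x_{k+q+1},\dots,x_{p+q+1}\big),$$ where $\mathbb S_{(i,j)}$ is the set of $(i,j)$-shuffles. $(C^\bullet(E,E),[\cdot,\cdot]_{\mathsf B})$ is a graded Lie algebra. Take $E=\mathfrak g\oplus V$. A map from a tensor product of copies of $\mathfrak g$ and $V$ (in a given order) to $\mathfrak g$ or $V$ is viewed in $C^\bullet(E,E)$ by extending it by zero on all other tensor components. Then $L'=\bigoplus_{n\ge0}\big(\mathrm{Hom}(\wedge^{n+1}\mathfrak g,\mathfrak g)\oplus\mathrm{Hom}(\wedge^n\mathfrak g\otimes V,V)\big)$ is a graded Lie subalgebra ($n$-th summand in degree $n$), $\mathfrak h=\bigoplus_{n\ge0}\mathrm{Hom}(\otimes^{n+1}V,\mathfrak g)$ is an abelian graded Lie subalgebra ($n$-th summand in degree $n$), and $P$ is the projection of $C^\bullet(E,E)$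 onto $\mathfrak h$ keeping only the component $\otimes^{n+1}V\to\mathfrak g$. $s^{-1}$ is the desuspension, $(s^{-1}L')^i=L'^{\,i+1}$. An $L_\infty$-algebra is a $\mathbb Z$-graded vector space with degree $1$ graded symmetric multilinear maps $l_k$, $k\ge1$, such that $\sum_{i=1}^n\sum_{\sigma\in\mathbb S_{(i,n-i)}}\varepsilon(\sigma)l_{n-i+1}(l_i(x_{\sigma(1)},\dots,x_{\sigma(i)}),x_{\sigma(i+1)},\dots,x_{\sigma(n)})=0$ for all $n\ge1$, $\varepsilon(\sigma)$ being the Koszul sign. *)

(* Defs.v *)
From HB Require Import structures.
From mathcomp Require Import all_boot all_order all_fingroup all_algebra.
From mathcomp Require Import boolp functions.
Set Implicit Arguments.
Unset Strict Implicit.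
Unset Printing Implicit Defensive.
Import GRing.Theory.
Local Open Scope ring_scope.

(* A family (f_n)_n of n-ary maps U^n -> W is encoded as one function         *)
(* f : seq U -> W, with f_n the restriction of f to sequences of size n.      *)
(* Positions are counted from 0.                                              *)

Definition multilinear (F : fieldType) (U W : lmodType F) (f : seq U -> W) :=
  forall (s t : seq U) (a : F) (x y : U),
    f (s ++ (a *: x + y) :: t) = a *: f (s ++ x :: t) + f (s ++ y :: t).

(* (f_n)_n lies in the direct sum, not just in the product, over n. *)
Definition bounded_arity (F : fieldType) (U W : lmodType F) (f : seq U -> W) :=
  exists N : nat, forall s, (N < size s)%N -> f s = 0.

(* Vanishing on repeated arguments: f_n factors through the n-th exterior     *)
(* power.                                                                     *)
Definition alternating (F : fieldType) (U W : lmodType F) (f : seq U -> W) :=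
  forall s, ~~ uniq s -> f s = 0.

(* (x_0, ..., x_{n-1}) |-> (x_{sigma 0}, ..., x_{sigma (n-1)}); only the      *)
(* first n entries of the sequence are used.                                  *)
Definition permute (F : fieldType) (U : lmodType F) (n : nat) (sigma : 'S_n)
    (s : seq U) : seq U :=
  [seq s`_(sigma i) | i : 'I_n].

(* (i, n - i)-shuffles *)
Definition shuffle (i n : nat) (sigma : 'S_n) : bool :=
  [forall a : 'I_n, forall b : 'I_n,
    (a < b)%N && ((b < i)%N || (i <= a)%N) ==> (sigma a < sigma b)%N].

Section LInfinity.
Variables (F : fieldType) (W : lmodType F).

(* hom i is the subspace of homogeneous elements of degree i; W is the direct *)
(* sum of these subspaces.                                                    *)
Record is_grading (hom : int -> W -> Prop) : Prop := IsGrading {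
  grading0 : forall i, hom i 0;
  gradingP : forall i (a : F) (x y : W), hom i x -> hom i y ->
    hom i (a *: x + y);
  grading_sum : forall w : W, exists (s : seq int) (c : int -> W),
    (forall i, hom i (c i)) /\ w = \sum_(i <- s) c i;
  grading_direct : forall (s : seq int) (c : int -> W), uniq s ->
    (forall i, hom i (c i)) -> \sum_(i <- s) c i = 0 ->
    forall i, i \in s -> c i = 0
}.

(* ds lists degrees of the homogeneous elements xs *)
Definition homogeneous_seq (hom : int -> W -> Prop) (ds : seq int)
    (xs : seq W) : Prop :=
  size ds = size xs /\
  forall i : nat, (i < size xs)%N -> hom (ds`_i) (xs`_i).

(* x_0 ... x_{n-1} = koszul ds sigma * x_{sigma 0} ... x_{sigma (n-1)} in the *)
(* free graded commutative algebra, x_i having degree ds`_i.                  *)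
Definition koszul (ds : seq int) (n : nat) (sigma : 'S_n) : F :=
  \prod_(a < n) \prod_(b < n | (a < b)%N && (sigma b < sigma a)%N)
    (-1) ^+ absz (ds`_(sigma a) * ds`_(sigma b)).

Definition graded_symmetric (hom : int -> W -> Prop) (l : seq W -> W) :=
  forall (ds : seq int) (xs : seq W), homogeneous_seq hom ds xs ->
  forall sigma : 'S_(size xs), l (permute sigma xs) = koszul ds sigma *: l xs.

(* l_k is the restriction of l to sequences of size k >= 1; the value of l on *)
(* the empty sequence plays no role.                                          *)
Record Linfty_algebra (hom : int -> W -> Prop) (l : seq W -> W) : Prop :=
LinftyAlgebra {
  Linfty_grading : is_grading hom;
  Linfty_multilinear : multilinear l;
  Linfty_symmetric : graded_symmetric hom l;
  Linfty_degree : forall (ds : seq int) (xs : seq W), (0 < size xs)%N ->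
    homogeneous_seq hom ds xs -> hom (\sum_(d <- ds) d + 1) (l xs);
  Linfty_jacobi : forall (ds : seq int) (xs : seq W), (0 < size xs)%N ->
    homogeneous_seq hom ds xs ->
    \sum_(1 <= i < (size xs).+1) \sum_(sigma : 'S_(size xs) | shuffle i sigma)
      koszul ds sigma *:
        l (l (take i (permute sigma xs)) :: drop i (permute sigma xs)) = 0
}.

End LInfinity.

Section Balavoine.
Variables (F : fieldType) (E : lmodType F).
Implicit Types f g : seq E -> E.

(* An element of C(E, E) is a map seq E -> E; its component of degree n is    *)
(* its restriction to sequences of size n + 1.                                *)
Definition has_degree (n : int) f : Prop :=
  forall s, (size s)%:Z != n + 1 -> f s = 0.

(* f o_(k+1) g for g of degree q, evaluated at s of size p + q + 1, where p   *)
(* is the degree of f.                                                        *)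
Definition insert (q k : nat) f g (s : seq E) : E :=
  \sum_(sigma : 'S_(k + q) | shuffle k sigma)
    ((-1) ^+ (k * q) * (-1) ^+ sigma) *:
      f (take k (permute sigma s)
         ++ g (rcons (drop k (permute sigma s)) s`_(k + q))
         :: drop (k + q).+1 s).

Definition barcomp (p q : nat) f g (s : seq E) : E :=
  \sum_(k < p.+1) insert q k f g s.

(* The bilinear extension to all of C(E, E): on a sequence of size n + 1 one  *)
(* gets the sum of the brackets [f_p, g_q] over p + q = n.                    *)
Definition balavoine f g : seq E -> E := fun s =>
  \sum_(q < size s) let p := (size s - q.+1)%N in
    (barcomp p q f g s - (-1) ^+ (p * q) *: barcomp q p g f s).

End Balavoine.

Section Spaces.
Variables (F : fieldType) (g V : lmodType F).
Local Notation E := (g * V)%type.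

(* Extension by zero of maps g (x) ... (x) g -> g, g (x) ... (x) g (x) V -> V *)
(* and V (x) ... (x) V -> g to maps E (x) ... (x) E -> E.                     *)
Definition ext_g (alpha : seq g -> g) : seq E -> E := fun s =>
  (alpha [seq x.1 | x <- s], 0).

Definition ext_gV (beta : seq g -> V -> V) : seq E -> E := fun s =>
  if s is x :: s' then (0, beta [seq y.1 | y <- belast x s'] (last x s').2)
  else 0.

Definition ext_V (theta : seq V -> g) : seq E -> E := fun s =>
  (theta [seq x.2 | x <- s], 0).

(* beta [::] ranges over Hom(V, V), the case n = 0 of Hom(/\^n g (x) V, V),    *)
(* whereas alpha [::] and theta [::] have no counterpart and are set to 0.    *)
Definition Lprime_prop (f : seq E -> E) : Prop :=
  exists (alpha : seq g -> g) (beta : seq g -> V -> V),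
  [/\ [/\ alpha [::] = 0, multilinear alpha, alternating alpha
        & bounded_arity alpha],
      [/\ (forall v, multilinear (beta^~ v)),
          (forall s (a : F) v w, beta s (a *: v + w) = a *: beta s v + beta s w),
          (forall v, alternating (beta^~ v))
        & exists N : nat, forall s v, (N < size s)%N -> beta s v = 0]
    & f = ext_g alpha \+ ext_gV beta].

Definition hh_prop (f : seq E -> E) : Prop :=
  exists theta : seq V -> g,
  [/\ theta [::] = 0, multilinear theta, bounded_arity theta & f = ext_V theta].

Definition Lprime_pred : {pred (seq E -> E)} := fun f => `[< Lprime_prop f >].
Definition hh_pred : {pred (seq E -> E)} := fun f => `[< hh_prop f >].

Lemma Lprime_submod_closed : submod_closed Lprime_pred.
Proof.
split.
  apply/asboolP; exists (fun=> 0), (fun _ _ => 0); split.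
  - split=> //; last by exists 0%N.
    by move=> s t a x y; rewrite scaler0 addr0.
  - split=> //; last by exists 0%N.
      by move=> v s t a x y; rewrite scaler0 addr0.
    by move=> s a v w; rewrite scaler0 addr0.
  apply/funext => -[|x s]; by rewrite /ext_g /ext_gV /= addr0.
move=> c f1 f2 /asboolP[a1 [b1 [[a10 a1m a1a [N1 a1b]] [b1m b1l b1a [M1 b1b]] ->]]].
move=> /asboolP[a2 [b2 [[a20 a2m a2a [N2 a2b]] [b2m b2l b2a [M2 b2b]] ->]]].
apply/asboolP; exists (fun s => c *: a1 s + a2 s).
exists (fun s v => c *: b1 s v + b2 s v); split.
- split.
  + by rewrite a10 a20 scaler0 addr0.
  + move=> s t a x y; rewrite a1m a2m !scalerDr !scalerA (mulrC c).
    by rewrite addrACA.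
  + by move=> s us; rewrite a1a// a2a// scaler0 addr0.
  + exists (maxn N1 N2) => s; rewrite gtn_max => /andP[s1 s2].
    by rewrite a1b// a2b// scaler0 addr0.
- split.
  + move=> v s t a x y; rewrite (b1m v) (b2m v) !scalerDr !scalerA (mulrC c).
    by rewrite addrACA.
  + move=> s a v w; rewrite b1l b2l !scalerDr !scalerA (mulrC c).
    by rewrite addrACA.
  + by move=> v s us; rewrite (b1a v)// (b2a v)// scaler0 addr0.
  + exists (maxn M1 M2) => s v; rewrite gtn_max => /andP[s1 s2].
    by rewrite b1b// b2b// scaler0 addr0.
- apply/esym/funext => s; apply: injective_projections.
  + case: s => [|x s].
      change (c *: a1 [::] + a2 [::] + 0 =
              c *: (a1 [::] + 0) + (a2 [::] + 0)).
      by rewrite !addr0.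
    set t := [seq y.1 | y <- x :: s].
    change (c *: a1 t + a2 t + 0 = c *: (a1 t + 0) + (a2 t + 0)).
    by rewrite !addr0.
  + case: s => [|x s].
      change (0 + 0 = c *: (0 + 0) + (0 + 0) :> V).
      by rewrite !addr0 scaler0.
    set t := [seq y.1 | y <- belast x s]; set v := (last x s).2.
    change (0 + (c *: b1 t v + b2 t v) =
            c *: (0 + b1 t v) + (0 + b2 t v)).
    by rewrite !add0r.
Qed.

Lemma hh_submod_closed : submod_closed hh_pred.
Proof.
split.
  apply/asboolP; exists (fun=> 0); split=> //; last by exists 0%N.
  by move=> s t a x y; rewrite scaler0 addr0.
move=> c f1 f2 /asboolP[a1 [a10 a1m [N1 a1b] ->]].
move=> /asboolP[a2 [a20 a2m [N2 a2b] ->]].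
apply/asboolP; exists (fun s => c *: a1 s + a2 s); split.
- by rewrite a10 a20 scaler0 addr0.
- move=> s t a x y; rewrite a1m a2m !scalerDr !scalerA (mulrC c).
  by rewrite addrACA.
- exists (maxn N1 N2) => s; rewrite gtn_max => /andP[s1 s2].
  by rewrite a1b// a2b// scaler0 addr0.
- apply/funext => s; apply: injective_projections => //.
  change (c *: 0 + 0 = 0 :> V).
  by rewrite scaler0 addr0.
Qed.

HB.instance Definition _ := GRing.isSubmodClosed.Build F _ Lprime_pred
  Lprime_submod_closed.
HB.instance Definition _ := GRing.isSubmodClosed.Build F _ hh_pred
  hh_submod_closed.

Record Lprime := LprimeSub {
  Lprime_val :> seq E -> E; _ : Lprime_val \in Lprime_pred }.
HB.instance Definition _ := [isSub for Lprime_val].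
HB.instance Definition _ := [Choice of Lprime by <:].
HB.instance Definition _ := [SubChoice_isSubLmodule of Lprime by <:].

Record hh := HhSub { hh_val :> seq E -> E; _ : hh_val \in hh_pred }.
HB.instance Definition _ := [isSub for hh_val].
HB.instance Definition _ := [Choice of hh by <:].
HB.instance Definition _ := [SubChoice_isSubLmodule of hh by <:].

Definition proj_hh (f : seq E -> E) : seq E -> E :=
  ext_V (fun s => (f [seq (0, v) | v <- s]).1).

(* s^{-1} L' (+) hh: the first factor is the desuspension of L', whose degree *)
(* i part is the degree i + 1 part of L'.                                     *)
Definition sLh := (Lprime * hh)%type.
HB.instance Definition _ := GRing.Lmodule.on sLh.

Definition sLh_hom (i : int) (w : sLh) : Prop :=
  has_degree (i + 1) w.1 /\ has_degree i w.2.

Definition desusp (Q : Lprime) : sLh := (Q, 0).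
Definition inhh (theta : hh) : sLh := (0, theta).
Definition insLh (z : Lprime + hh) : sLh :=
  match z with inl Q => desusp Q | inr theta => inhh theta end.

(* Permutations of the arguments below are governed by derived_symmetric; in  *)
(* derived_vanish, m counts the arguments from s^{-1} L' (so l_1 = 0).        *)
Record derived_brackets (l : seq sLh -> sLh) : Prop := DerivedBrackets {
  derived_multilinear : multilinear l;
  derived_symmetric : graded_symmetric sLh_hom l;
  derived_LL : forall (n n' : nat) (Q Q' : Lprime),
    has_degree n Q -> has_degree n' Q' ->
    exists2 R : Lprime, R = (-1) ^+ n *: balavoine Q Q' :> (seq E -> E)
      & l [:: desusp Q; desusp Q'] = desusp R;
  derived_Lh : forall (n : nat) (Q : Lprime) (ts : seq hh),
    has_degree n Q -> (0 < size ts)%N ->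
    (forall t, t \in ts -> exists d : nat, has_degree d t) ->
    exists2 eta : hh,
      eta = proj_hh (foldl (@balavoine F E) Q (map hh_val ts)) :> (seq E -> E)
      & l (desusp Q :: map inhh ts) = inhh eta;
  derived_vanish : forall zs : seq (Lprime + hh),
    let m := count is_inl zs in
    ~~ ((m == 1) && (2 <= size zs))%N -> ~~ ((m == 2) && (size zs == 2))%N ->
    l (map insLh zs) = 0
}.

End Spaces.

(* Main.v *)
(* On multilinear maps, inserting g into f satisfies                          *)
(*   (f o g)(x :: s) = (f_x o g')(s) + (f o g_x)(s) + f (g [x] :: s),         *)
(* where f_x = f (x :: -) and g' is g up to the sign of its degree: x goes    *)
(* either outside g, or inside g before its last argument, or is that last    *)
(* argument. Induction on the sequence with this recursion shows that the     *)
(* commutator of the operators - o g and - o h is - o [g, h] up to sign,      *)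
(* hence the graded Jacobi identity, and that L' is closed under the bracket. *)
(* Sums over shuffles are turned into the same kind of recursion by splitting *)
(* off the first letter, which occupies the first place of one of the two     *)
(* blocks.                                                                    *)
(*                                                                            *)
(* The Jacobiator of the derived brackets is additive and graded symmetric,   *)
(* so it is enough to evaluate it on s^{-1}Q_1, ..., s^{-1}Q_m followed by    *)
(* elements of hh. For degree reasons only m = 2, and m = 3 without elements  *)
(* of hh, can contribute. The latter is the Jacobi identity of L'. The former *)
(* follows by expanding [...[[Q, Q'], t_1], ..., t_k] with the derivation     *)
(* rule, and using P[a, b] = P[Pa, b] + P[a, Pb], which holds because hh is   *)
(* abelian and ker P is closed under the bracket.                             *)

Require Import Defs.
From HB Require Import structures.
From mathcomp Require Import all_boot all_order all_fingroup all_algebra.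
From mathcomp Require Import boolp functions ring zify.
Set Implicit Arguments.
Unset Strict Implicit.
Unset Printing Implicit Defensive.
Import GRing.Theory.
Local Open Scope ring_scope.

(** * Linear identities in modules, by reflection *)

(** The construction is an instance of higher derived brackets. In the graded Lie algebra C(E, E)
    the subspace [hh] is abelian, ker P is closed under the bracket, and L' is a subalgebra
    contained in ker P. Hence P[a, b] = P[Pa, b] + P[a, Pb] ([proj_bal]). Bracketing with elements
    of [hh] is a derivation ([fold_bal_split]), and such operations commute up to sign
    ([fold_bal_comm]). Together these give [proj_fold_bal]: the derived bracket of [Q, Q'] is a
    signed sum, over splittings of the arguments from [hh], of nested derived brackets of Q and Q'.
    This is the Jacobi identity with two arguments from L' ([jac_LL]). With three, and none from
    [hh], it is the Jacobi identity of L' ([jac_LLL]). Counting arguments excludes all other cases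
    ([jac_term_vanish]).

    The graded Jacobi identity [bal_leibniz] rests on the graded pre-Lie identity [insf_commutator]:
    inserting two maps into distinct arguments is symmetric up to sign. It is proved for [bal], a
    form of the bracket defined by recursion on the arguments, which [balavoineE] compares with the
    shuffle formula. L' is closed under [bal] because the conditions of [Lprime_propP] pass to
    insertions ([lrel_ins], [lswap_ins]).

    The brackets are prescribed on homogeneous elements of the two summands only. [gen_ind] and
    [jac_swap] reduce the Jacobi identity to such elements, those of L' coming first;
    [derived_bracket] extends the prescription to all of [sLh], which proves existence. *)

Section ModuleIdentities.
Variables (F : comNzRingType) (W : lmodType F).

Inductive lincomb :=
  LAtom of nat | LZero | LAdd of lincomb & lincomb | LOpp of lincomb
| LScale of F & lincomb.

Fixpoint lin_eval (ws : seq W) (e : lincomb) : W :=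
  match e with
  | LAtom i => ws`_i
  | LZero => 0
  | LAdd a b => lin_eval ws a + lin_eval ws b
  | LOpp a => - lin_eval ws a
  | LScale c a => c *: lin_eval ws a
  end.

Fixpoint lin_coef (i : nat) (e : lincomb) : F :=
  match e with
  | LAtom j => if j == i then 1 else 0
  | LZero => 0
  | LAdd a b => lin_coef i a + lin_coef i b
  | LOpp a => - lin_coef i a
  | LScale c a => c * lin_coef i a
  end.

Lemma lin_evalE ws e :
  lin_eval ws e = \sum_(i < size ws) lin_coef i e *: ws`_i.
Proof.
elim: e => [j||a IHa b IHb|a IHa|c a IHa] /=; rewrite ?IHa ?IHb.
- have [lt|ge] := ltnP j (size ws); last first.
    rewrite nth_default// big1// => i _.
    by rewrite gtn_eqF ?scale0r// (leq_trans (ltn_ord i)).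
  rewrite (bigD1 (Ordinal lt))//= eqxx scale1r big1 ?addr0// => i ne.
  by rewrite eq_sym -val_eqE /= in ne; rewrite (negPf ne) scale0r.
- by rewrite big1// => i _; rewrite scale0r.
- by rewrite -big_split; apply: eq_bigr => i _; rewrite scalerDl.
- by rewrite -sumrN; apply: eq_bigr => i _; rewrite scaleNr.
- by rewrite scaler_sumr; apply: eq_bigr => i _; rewrite scalerA.
Qed.

Fixpoint lin_same (n : nat) (a b : lincomb) : Prop :=
  if n is n'.+1 then lin_coef n' a = lin_coef n' b /\ lin_same n' a b else True.

Lemma lin_sameP ws a b : lin_same (size ws) a b ->
  lin_eval ws a = lin_eval ws b.
Proof.
rewrite !lin_evalE; move: (size ws) => n; elim: n => [|n IH] /=.
  by rewrite !big_ord0.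
by case=> ab /IH e; rewrite !big_ord_recr /= ab e.
Qed.

End ModuleIdentities.

Ltac lin_index w ws :=
  match ws with
  | ?w' :: _ => let _ := constr:(erefl : w = w') in constr:(O)
  | _ :: ?ws' => let i := lin_index w ws' in constr:(S i)
  end.

Ltac lin_mem w ws :=
  match ws with
  | nil => constr:(false)
  | ?w' :: _ => let _ := constr:(erefl : w = w') in constr:(true)
  | _ :: ?ws' => lin_mem w ws'
  end.

Ltac lin_atoms e ws :=
  lazymatch e with
  | (?a + ?b)%R => let ws := lin_atoms a ws in lin_atoms b ws
  | (- ?a)%R => lin_atoms a ws
  | (_ *: ?a)%R => lin_atoms a ws
  | 0%R => ws
  | _ => lazymatch lin_mem e ws with
         | true => ws
         | false => constr:(e :: ws)
         end
  end.

Ltac lin_reify F ws e :=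
  lazymatch e with
  | (?a + ?b)%R => let a := lin_reify F ws a in
                   let b := lin_reify F ws b in constr:(LAdd a b)
  | (- ?a)%R => let a := lin_reify F ws a in constr:(LOpp a)
  | (?c *: ?a)%R => let a := lin_reify F ws a in constr:(LScale c a)
  | 0%R => constr:(@LZero F)
  | _ => let i := lin_index e ws in constr:(@LAtom F i)
  end.

(** Compares two linear combinations coefficient by coefficient; atoms are identified up to
    conversion, and the equations between coefficients are left to [tac]. *)
Ltac lin_with F tac :=
  lazymatch goal with
  | |- @eq ?T ?a ?b =>
    let ws := lin_atoms a (@nil T) in
    let ws := lin_atoms b ws in
    let a' := lin_reify F ws a in
    let b' := lin_reify F ws b in
    apply: (@lin_sameP F _ ws a' b');
    rewrite /=; do ?[split; last (by []) | split]; try (by []); tac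
  end.

Tactic Notation "lin" constr(F) := lin_with F ltac:(try ring).

(** * Insertion of multilinear maps *)

Definition lpart (T W : Type) (x : T) (f : seq T -> W) : seq T -> W :=
  fun s => f (x :: s).

Section Insertion.
Variable F : fieldType.
Implicit Types U W : lmodType F.

(** One scalar per arity covers signs depending on the degree as well as projections onto some of
    the degrees. *)
Definition rescale (c : nat -> F) U W (f : seq U -> W) : seq U -> W :=
  fun s => c (size s) *: f s.

(** Arity [n] is degree [n - 1], so each component is multiplied by the sign of its degree. *)
Definition twist U W (f : seq U -> W) := rescale (fun n => (-1) ^+ n.+1) f.

(** For multilinear [f] this is the shuffle sum of the Balavoine product, by [sum_barcomp]. With the
    recursion as definition, identities follow by induction on [s]; the twist is the sign of moving
    [x] past [g]. *)
Fixpoint ins U W (s : seq U) (g : seq U -> U) (f : seq U -> W) : W :=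
  if s is x :: s' then
    ins s' (twist g) (lpart x f) + ins s' (lpart x g) f + f (g [:: x] :: s')
  else 0.

Lemma multilinear_lpart U W x (f : seq U -> W) :
  multilinear f -> multilinear (lpart x f).
Proof. by move=> fm s t a y z; rewrite /lpart -cat_cons fm. Qed.

Lemma multilinear_rescale c U W (f : seq U -> W) :
  multilinear f -> multilinear (rescale c f).
Proof.
move=> fm s t a y z; rewrite /rescale fm !size_cat /= scalerDr !scalerA.
by rewrite (mulrC a).
Qed.

Lemma multilinear_cons U W (f : seq U -> W) s a x y : multilinear f ->
  f (a *: x + y :: s) = a *: f (x :: s) + f (y :: s).
Proof. by move=> fm; apply: (fm [::]). Qed.

Lemma multilinear_cons0 U W (f : seq U -> W) s : multilinear f ->
  f (0 :: s) = 0.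
Proof.
by move=> fm; rewrite -[0 in LHS](subrr 0) addrC -scaleN1r multilinear_cons//
  scaleN1r addNr.
Qed.

Lemma multilinear0 U W (f : seq U -> W) s t : multilinear f ->
  f (s ++ 0 :: t) = 0.
Proof.
by move=> fm; rewrite -[0 in LHS](subrr 0) addrC -scaleN1r fm scaleN1r addNr.
Qed.

Lemma multilinearZ U W (f : seq U -> W) s t a x : multilinear f ->
  f (s ++ a *: x :: t) = a *: f (s ++ x :: t).
Proof. by move=> fm; rewrite -[a *: x]addr0 fm multilinear0// addr0. Qed.

Lemma multilinear_lin U W (f f' : seq U -> W) a : multilinear f ->
  multilinear f' -> multilinear (a *: f + f').
Proof.
move=> fm fm' s t b x y; rewrite !fctE fm fm' !scalerDr !scalerA (mulrC b).
by rewrite addrACA.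
Qed.

(** The recursion never evaluates either map at the empty sequence. [lswap_ins] relies on this. *)
Lemma eq_ins U W (s : seq U) (g g' : seq U -> U) (f f' : seq U -> W) :
    (forall x t, g (x :: t) = g' (x :: t)) ->
    (forall x t, f (x :: t) = f' (x :: t)) ->
  ins s g f = ins s g' f'.
Proof.
elim: s g g' f f' => //= x s IH g g' f f' gg' ff'.
rewrite gg' ff'; congr (_ + _ + _); apply: IH => // y t.
- by rewrite /twist /rescale gg'.
- by rewrite /lpart ff'.
- by rewrite /lpart gg'.
Qed.

Lemma ins_linear_outer U W (s : seq U) (g : seq U -> U) (f f' : seq U -> W) a :
  ins s g (a *: f + f') = a *: ins s g f + ins s g f'.
Proof.
elim: s g f f' => [|x s IH] g f f' /=; first by rewrite scaler0 addr0.
rewrite -[lpart x _]/(a *: lpart x f + lpart x f') !IH.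
by rewrite -[(a *: f + f') _]/(a *: f _ + f' _); lin F.
Qed.

Lemma ins_outer0 U W (s : seq U) g : ins s g (0 : seq U -> W) = 0.
Proof. by elim: s g => //= x s IH g; rewrite !IH !addr0. Qed.

Lemma twist_lin U W (g g' : seq U -> W) a :
  twist (a *: g + g') = a *: twist g + twist g'.
Proof.
by apply/funext => s; rewrite /twist /rescale !fctE; lin F.
Qed.

Lemma ins_linear_inner U W (s : seq U) (g g' : seq U -> U) (f : seq U -> W) a :
  multilinear f -> ins s (a *: g + g') f = a *: ins s g f + ins s g' f.
Proof.
elim: s g g' f => [|x s IH] g g' f fm /=; first by rewrite scaler0 addr0.
rewrite twist_lin -[lpart x (_ + _)]/(a *: lpart x g + lpart x g') !IH//;
  last first.
  exact: multilinear_lpart.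
by rewrite -[(a *: g + g') _]/(a *: g _ + g' _) multilinear_cons//; lin F.
Qed.

Lemma ins_scale_inner U W (s : seq U) (g : seq U -> U) (f : seq U -> W) a :
  multilinear f -> ins s (a *: g) f = a *: ins s g f.
Proof.
elim: s g f => [|x s IH] g f fm /=; first by rewrite scaler0.
have -> : twist (a *: g) = a *: twist g.
  by apply/funext => t; rewrite /twist /rescale !fctE; lin F.
rewrite -[lpart x (_ *: _)]/(a *: lpart x g) !IH//;
  last exact: multilinear_lpart.
rewrite -[(a *: g) _]/(a *: g _) -[X in f (X :: s)]addr0 multilinear_cons//.
by rewrite multilinear_cons0//; lin F.
Qed.

Lemma ins_inner0 U W (s : seq U) (f : seq U -> W) :
  multilinear f -> ins s (0 : seq U -> U) f = 0.
Proof. by move=> fm; rewrite -(scale0r 0) ins_scale_inner// scale0r. Qed.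

Lemma multilinear_ins U W g (f : seq U -> W) :
  multilinear g -> multilinear f -> multilinear (fun s => ins s g f).
Proof.
move=> gm fm s t a x y.
elim: s g f gm fm => [|z s IH] g f gm fm /=.
  have -> : lpart (a *: x + y) f = a *: lpart x f + lpart y f.
    by apply/funext => u; rewrite /lpart multilinear_cons.
  have -> : lpart (a *: x + y) g = a *: lpart x g + lpart y g.
    by apply/funext => u; rewrite /lpart multilinear_cons.
  rewrite ins_linear_outer ins_linear_inner// !multilinear_cons//.
  by lin F.
rewrite !IH//; try exact: multilinear_lpart; try exact: multilinear_rescale.
by rewrite -!cat_cons fm; lin F.
Qed.

Definition sg (b : bool) : F := (-1) ^+ b.

(* The degree of f s being size s - 1, the degree of f has parity b. *)
Definition parity (b : bool) U W (f : seq U -> W) :=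
  forall s, odd (size s) = b -> f s = 0.

Lemma parity_lpart b U W x (f : seq U -> W) :
  parity b f -> parity (~~ b) (lpart x f).
Proof. by move=> fb s sb; apply: fb; rewrite /= sb negbK. Qed.

Lemma parity_twist b U W (f : seq U -> W) :
  parity b f -> parity b (twist f).
Proof. by move=> fb s sb; rewrite /twist /rescale fb// scaler0. Qed.

Lemma twist_parity b U W (f : seq U -> W) :
  parity b f -> twist f = sg b *: f.
Proof.
move=> fb; apply/funext => s; rewrite /twist /rescale !fctE.
case: (eqVneq (odd (size s)) b) => [/fb ->|ne]; first by rewrite !scaler0.
congr (_ *: _); rewrite /sg -signr_odd /=; by move: ne {fb};
  case: (odd _) b => [] [].
Qed.

Lemma parity_lin b U W (f f' : seq U -> W) a : parity b f -> parity b f' ->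
  parity b (a *: f + f').
Proof.
by move=> fb fb' s sb; rewrite !fctE fb// fb'// scaler0 addr0.
Qed.

Lemma parity_ins b c U W (g : seq U -> U) (f : seq U -> W) :
  multilinear f -> parity b g -> parity c f ->
  parity (b (+) c) (fun s => ins s g f).
Proof.
move=> fm gb fc s.
elim: s b c g f fm gb fc => //= x s IH b c g f fm gb fc sbc.
rewrite (IH b (~~ c))//; first 1 last.
- exact: multilinear_lpart.
- exact: parity_twist.
- exact: parity_lpart.
- by rewrite addbN -sbc negbK.
rewrite (IH (~~ b) c)//; first 1 last.
- exact: parity_lpart.
- by rewrite addNb -sbc negbK.
rewrite !add0r; case: b {IH} => [|] in gb sbc *.
  by rewrite gb//= multilinear_cons0.
by rewrite fc//= sbc; case: c {fc sbc}.
Qed.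

Definition insf U W (g : seq U -> U) (f : seq U -> W) : seq U -> W :=
  fun s => ins s g f.

Lemma lpart_insf U W x (g : seq U -> U) (f : seq U -> W) :
  lpart x (insf g f) =
  insf (twist g) (lpart x f) + insf (lpart x g) f + lpart (g [:: x]) f.
Proof. by []. Qed.

Lemma ins_twist b U W (s : seq U) (g : seq U -> U) (f : seq U -> W) :
  multilinear f -> parity b g -> ins s (twist g) f = sg b *: ins s g f.
Proof. by move=> fm gb; rewrite (twist_parity gb) ins_scale_inner. Qed.

Lemma insf_twist b U W (g : seq U -> U) (f : seq U -> W) :
  multilinear f -> parity b g -> insf (twist g) f = sg b *: insf g f.
Proof. by move=> fm gb; apply/funext => s; apply: ins_twist. Qed.

Lemma ins_outerD U W (s : seq U) (g : seq U -> U) (f f' : seq U -> W) :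
  ins s g (f + f') = ins s g f + ins s g f'.
Proof. by rewrite -[f in LHS]scale1r ins_linear_outer scale1r. Qed.

Lemma ins_outerZ U W (s : seq U) (g : seq U -> U) (f : seq U -> W) a :
  ins s g (a *: f) = a *: ins s g f.
Proof. by rewrite -[a *: f]addr0 ins_linear_outer ins_outer0 addr0. Qed.

Lemma ins_innerD U W (s : seq U) (g g' : seq U -> U) (f : seq U -> W) :
  multilinear f -> ins s (g + g') f = ins s g f + ins s g' f.
Proof. by move=> fm; rewrite -[g in LHS]scale1r ins_linear_inner// scale1r. Qed.

Lemma ins_lpart_insf b U W x (h : seq U -> U) (g : seq U -> U) (f :
  seq U -> W) s :
    multilinear f -> parity b g ->
  ins s h (lpart x (insf g f)) =
  sg b *: ins s h (insf g (lpart x f)) + ins s h (insf (lpart x g) f) +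
  ins s h (lpart (g [:: x]) f).
Proof.
move=> fm gb; rewrite lpart_insf (insf_twist (multilinear_lpart _ fm) gb).
by rewrite !ins_outerD ins_outerZ.
Qed.

Lemma insf_lpart_insf b U W x (h : seq U -> U) (g : seq U -> U) (f :
  seq U -> W) s :
    multilinear f -> multilinear h -> parity b g ->
  ins s (lpart x (insf g h)) f =
  sg b *: ins s (insf g (lpart x h)) f + ins s (insf (lpart x g) h) f +
  ins s (lpart (g [:: x]) h) f.
Proof.
move=> fm hm gb; rewrite lpart_insf (insf_twist (multilinear_lpart _ hm) gb).
by rewrite !ins_innerD// ins_scale_inner.
Qed.

Lemma lpart0 U W (f : seq U -> W) : multilinear f -> lpart 0 f = 0.
Proof. by move=> fm; apply/funext => s; rewrite /lpart multilinear_cons0. Qed.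

(** The graded pre-Lie identity: terms with [g] and [h] in distinct arguments of [f] cancel, and the
    nested ones remain. Each branch of the recursion replaces one of the three maps by its [lpart],
    which is an induction hypothesis. *)
Lemma ins_commutator b c U W (g h : seq U -> U) (f : seq U -> W) s :
    multilinear f -> multilinear g -> multilinear h ->
    parity b g -> parity c h ->
  ins s h (insf g f) - sg (b && c) *: ins s g (insf h f) =
  ins s (insf h g) f - sg (b && c) *: ins s (insf g h) f.
Proof.
elim: s b c g h f => [|x s IH] b c g h f fm gm hm gb hc /=.
  by rewrite scaler0 subr0.
have fxm y : multilinear (lpart y f) by exact: multilinear_lpart.
have gxm : multilinear (lpart x g) by exact: multilinear_lpart.
have hxm : multilinear (lpart x h) by exact: multilinear_lpart.
have ghm : multilinear (insf g f) by exact: multilinear_ins.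
have hgm : multilinear (insf h f) by exact: multilinear_ins.
rewrite (ins_twist _ _ hc); last by apply: multilinear_lpart.
rewrite (ins_twist _ _ gb); last by apply: multilinear_lpart.
rewrite (ins_twist _ (fxm x) (parity_ins gm hc gb)).
rewrite (ins_twist _ (fxm x) (parity_ins hm gb hc)).
rewrite !(ins_lpart_insf _ _ _ fm gb) !(ins_lpart_insf _ _ _ fm hc).
rewrite !(insf_lpart_insf _ _ fm _ gb)// !(insf_lpart_insf _ _ fm _ hc)//.
have := IH b c g h (lpart x f) (fxm x) gm hm gb hc.
have := IH (~~ b) c (lpart x g) h f fm gxm hm (parity_lpart x gb) hc.
have := IH b (~~ c) g (lpart x h) f fm gm hxm gb (parity_lpart x hc).
move=> /eqP; rewrite subr_eq => /eqP ->.
move=> /eqP; rewrite subr_eq => /eqP ->.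
move=> /eqP; rewrite subr_eq => /eqP ->.
rewrite /insf /= !add0r (ins_twist _ (fxm _) gb) (ins_twist _ (fxm _) hc).
(* A unary component has degree 0, so it vanishes for a map of odd parity. *)
have gx0 : b -> g [:: x] = 0 by move=> tb; apply: gb.
have hx0 : c -> h [:: x] = 0 by move=> tc; apply: hc.
case: b c gx0 hx0 {gb hc} => [] [] gx0 hx0;
  rewrite ?(gx0 isT) ?(hx0 isT) ?lpart0 ?ins_inner0 ?ins_outer0
    ?multilinear_cons0// /sg /=; lin F.
Qed.

Lemma insf_outerD U W g (f f' : seq U -> W) :
  insf g (f + f') = insf g f + insf g f'.
Proof. by apply/funext => s; apply: ins_outerD. Qed.

Lemma insf_outerZ U W g (f : seq U -> W) a : insf g (a *: f) = a *: insf g f.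
Proof. by apply/funext => s; apply: ins_outerZ. Qed.

Lemma insf_innerD U W (g g' : seq U -> U) (f : seq U -> W) :
  multilinear f -> insf (g + g') f = insf g f + insf g' f.
Proof. by move=> fm; apply/funext => s; apply: ins_innerD. Qed.

Lemma insf_innerZ U W (g : seq U -> U) (f : seq U -> W) a :
  multilinear f -> insf (a *: g) f = a *: insf g f.
Proof. by move=> fm; apply/funext => s; apply: ins_scale_inner. Qed.

Lemma insf_commutator b c U W (g h : seq U -> U) (f : seq U -> W) :
    multilinear f -> multilinear g -> multilinear h ->
    parity b g -> parity c h ->
  insf h (insf g f) - sg (b && c) *: insf g (insf h f) =
  insf (insf h g) f - sg (b && c) *: insf (insf g h) f.
Proof. by move=> *; apply/funext => s; apply: ins_commutator. Qed.

End Insertion.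

(** * The Balavoine bracket in terms of insertions *)

Section Bracket.
Variables (F : fieldType) (E : lmodType F).
Implicit Types f g h : seq E -> E.
Local Notation sg := (@sg F).

(** Even refers to the degree, which is one less than the arity. *)
Definition even_part f := rescale (fun n => (odd n)%:R) f.
Definition odd_part f := rescale (fun n => (~~ odd n)%:R) f.

(** The sign (-1)^(pq) is 1 for even p and (-1)^q for odd p. Splitting [f] by parity and twisting
    [g] therefore gives the bracket without choosing degrees. *)
Definition bal f g : seq E -> E :=
  insf g f - insf (even_part f) g - insf (odd_part f) (twist g).

Lemma even_part_parity b f : parity b f -> even_part f = (~~ b)%:R *: f.
Proof.
move=> fb; apply/funext => s; rewrite /even_part /rescale !fctE.
case: (eqVneq (odd (size s)) b) => [/fb ->|ne]; first by rewrite !scaler0.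
by move: ne {fb}; case: (odd _) b => [] [].
Qed.

Lemma odd_part_parity b f : parity b f -> odd_part f = b%:R *: f.
Proof.
move=> fb; apply/funext => s; rewrite /odd_part /rescale !fctE.
case: (eqVneq (odd (size s)) b) => [/fb ->|ne]; first by rewrite !scaler0.
by move: ne {fb}; case: (odd _) b => [] [].
Qed.

Lemma balE b c f g : multilinear f -> multilinear g ->
  parity b f -> parity c g -> bal f g = insf g f - sg (b && c) *: insf f g.
Proof.
move=> fm gm fb gc; apply/funext => s.
rewrite /bal (even_part_parity fb) (odd_part_parity fb) (twist_parity gc).
rewrite -[LHS]/(ins s g f - ins s ((~~ b)%:R *: f) g - ins s (b%:R *:
  f) (sg c *: g)).
rewrite ins_outerZ !ins_scale_inner// -[RHS]/(ins s g f - sg (b && c) *: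
  ins s f g).
by rewrite /sg; case: b c {fb gc} => [] [] /=; lin F.
Qed.

Lemma multilinear_bal f g : multilinear f -> multilinear g ->
  multilinear (bal f g).
Proof.
move=> fm gm; rewrite /bal -addrA -opprD addrC -scaleN1r.
apply: multilinear_lin; last exact: multilinear_ins.
rewrite -[X in X + _]scale1r; apply: multilinear_lin;
  apply: multilinear_ins => //;
  exact: multilinear_rescale.
Qed.

Lemma parity_bal b c f g : multilinear f -> multilinear g ->
  parity b f -> parity c g -> parity (b (+) c) (bal f g).
Proof.
move=> fm gm fb gc; rewrite (balE fm gm fb gc) addrC -scaleNr.
by apply: parity_lin; [|rewrite addbC]; apply: parity_ins.
Qed.

Lemma rescale_lin (W : lmodType F) c (f f' : seq E -> W) a :
  rescale c (a *: f + f') = a *: rescale c f + rescale c f'.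
Proof. by apply/funext => s; rewrite /rescale !fctE; lin F. Qed.

Lemma bal_linl f f' g a : multilinear g ->
  bal (a *: f + f') g = a *: bal f g + bal f' g.
Proof.
move=> gm; apply/funext => s; rewrite /bal /even_part /odd_part !rescale_lin.
rewrite !fctE /insf ins_linear_outer !ins_linear_inner//.
  by lin F.
exact: multilinear_rescale.
Qed.

Lemma bal_linr f g g' a : multilinear f ->
  bal f (a *: g + g') = a *: bal f g + bal f g'.
Proof.
move=> fm; apply/funext => s; rewrite /bal /twist !rescale_lin.
rewrite !fctE /insf ins_linear_inner// !ins_linear_outer.
by lin F.
Qed.

Lemma balDl f f' g : multilinear g -> bal (f + f') g = bal f g + bal f' g.
Proof. by move=> gm; rewrite -[f in LHS]scale1r bal_linl// scale1r. Qed.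

Lemma balDr f g g' : multilinear f -> bal f (g + g') = bal f g + bal f g'.
Proof. by move=> gm; rewrite -[g in LHS]scale1r bal_linr// scale1r. Qed.

Lemma bal0l g : multilinear g -> bal 0 g = 0.
Proof.
by move=> gm; apply: (addIr (bal 0 g)); rewrite -balDl// addr0 add0r.
Qed.

Lemma bal0r f : multilinear f -> bal f 0 = 0.
Proof.
by move=> gm; apply: (addIr (bal f 0)); rewrite -balDr// addr0 add0r.
Qed.

Lemma balZl a f g : multilinear g -> bal (a *: f) g = a *: bal f g.
Proof. by move=> gm; rewrite -[a *: f]addr0 bal_linl// bal0l// addr0. Qed.

Lemma bal_anti b c f g : multilinear f -> multilinear g ->
  parity b f -> parity c g -> bal f g = - sg (b && c) *: bal g f.
Proof.
move=> fm gm fb gc; rewrite (balE fm gm fb gc) (balE gm fm gc fb).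
by rewrite /sg; case: b c {fb gc} => [] [] /=; lin F.
Qed.

(* The graded Jacobi identity, as a derivation rule for [bal - h]. *)
Lemma bal_leibniz b c d f g h :
    multilinear f -> multilinear g -> multilinear h ->
    parity b f -> parity c g -> parity d h ->
  bal (bal f g) h = bal f (bal g h) + sg (c && d) *: bal (bal f h) g.
Proof.
move=> fm gm hm fb gc hd.
have fgm := multilinear_bal fm gm; have ghm := multilinear_bal gm hm.
have fhm := multilinear_bal fm hm.
have fgp := parity_bal fm gm fb gc; have ghp := parity_bal gm hm gc hd.
have fhp := parity_bal fm hm fb hd.
rewrite (balE fgm hm fgp hd) (balE fm ghm fb ghp) (balE fhm gm fhp gc).
rewrite (balE fm gm fb gc) (balE gm hm gc hd) (balE fm hm fb hd).
rewrite -!scaleNr !insf_outerD !insf_innerD// !insf_outerZ !insf_innerZ//.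
(* The pre-Lie identity with each of the three maps in turn as the outer one; what remains is
   linear. *)
have := insf_commutator fm gm hm gc hd.
have := insf_commutator gm fm hm fb hd.
have := insf_commutator hm fm gm fb gc.
move=> /eqP; rewrite subr_eq => /eqP ->.
move=> /eqP; rewrite subr_eq => /eqP ->.
move=> /eqP; rewrite subr_eq => /eqP ->.
rewrite /sg; case: b c d {fb gc hd fgp ghp fhp} => [] [] [] /=; lin F.
Qed.

End Bracket.

(** * Shuffle sums as recursive sums over splittings *)

Definition perm_seq (T : Type) (x0 : T) n (sigma : 'S_n) (s : seq T) : seq T :=
  [seq nth x0 s (sigma i) | i : 'I_n].

Section PermSeq.
Variables (T : Type) (x0 : T).

Lemma size_perm_seq n (sigma : 'S_n) s : size (perm_seq x0 sigma s) = n.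
Proof. by rewrite size_map size_enum_ord. Qed.

Lemma nth_perm_seq n (sigma : 'S_n) s (i : 'I_n) :
  nth x0 (perm_seq x0 sigma s) i = nth x0 s (sigma i).
Proof. by rewrite (nth_map i) ?size_enum_ord// nth_ord_enum. Qed.

(** [lift_perm j ord0 sigma] assigns the first letter to place [j] and arranges the others by
    [sigma]. *)
Lemma perm_seq_lift n (sigma : 'S_n) (j : 'I_n.+1) x s :
  perm_seq x0 (lift_perm j ord0 sigma) (x :: s) =
  take j (perm_seq x0 sigma s) ++ x :: drop j (perm_seq x0 sigma s).
Proof.
have sj : size (take j (perm_seq x0 sigma s)) = j.
  by rewrite size_take size_perm_seq; case: ltnP => //; have := ltn_ord j; lia.
apply: (@eq_from_nth _ x0) => [|i].
  rewrite size_perm_seq size_cat /= size_take size_drop size_perm_seq.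
  by case: ltnP; have := ltn_ord j; lia.
rewrite size_perm_seq => lti; rewrite (nth_perm_seq _ _ (Ordinal lti)).
rewrite nth_cat sj /=; case: (unliftP j (Ordinal lti)) => [k|] e.
  have ei : i = bump j k by have := congr1 val e.
  rewrite e lift_perm_lift /= -nth_perm_seq ei /bump.
  case: (leqP j k) => jk /=; rewrite ?add1n ?add0n.
    rewrite ltnNge (leq_trans jk)//= subSn//= nth_drop subnKC//.
  by rewrite jk nth_take.
have ei : i = j by have := congr1 val e.
by rewrite e lift_perm_id /= ei ltnn subnn.
Qed.

End PermSeq.

Lemma map_perm_seq (T T' : Type) (f : T -> T') x0 y0 n (sigma : 'S_n) s :
  size s = n -> map f (perm_seq x0 sigma s) = perm_seq y0 sigma (map f s).
Proof.
move=> sn; rewrite /perm_seq /image_mem -map_comp; apply: eq_map => i /=.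
by rewrite (nth_map x0)// sn.
Qed.

(** A permutation amounts to the place of the first letter and an arrangement of the rest;
    injectivity suffices by counting. *)
Lemma lift_perm_bij n :
  bijective (fun p : 'I_n.+1 * 'S_n => lift_perm p.1 ord0 p.2).
Proof.
apply: inj_card_bij => [[j s] [j' s'] /= e|]; last first.
  by rewrite card_prod card_ord !card_Sn factS.
have jj : j = j'.
  apply: (@perm_inj _ (lift_perm j ord0 s)).
  by rewrite lift_perm_id e lift_perm_id.
subst j'; congr (_, _); apply/permP => k; apply: (@lift_inj _ ord0).
by rewrite -!(lift_perm_lift j) e.
Qed.

Lemma lift_perm_ind (P : forall n, 'S_n -> Prop) :
  P 0%N 1%g ->
  (forall n (j : 'I_n.+1) (sigma : 'S_n), P n sigma ->
    P n.+1 (lift_perm j ord0 sigma)) ->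
  forall n (sigma : 'S_n), P n sigma.
Proof.
move=> P0 PS; elim=> [|n IH] sigma.
  by have -> : sigma = 1%g by apply/permP => -[].
have [h _ hK] := lift_perm_bij n; rewrite -(hK sigma).
exact: PS.
Qed.

Lemma sum_perm_lift (W : zmodType) n (G : 'S_n.+1 -> W) :
  \sum_sigma G sigma = \sum_(j < n.+1) \sum_(sigma :
    'S_n) G (lift_perm j ord0 sigma).
Proof.
rewrite pair_big /=.
rewrite (reindex (fun p : 'I_n.+1 * 'S_n => lift_perm p.1 ord0 p.2))//=.
by apply: onW_bij; apply: lift_perm_bij.
Qed.

Section Shuffles.
Variables (n : nat).
Implicit Types (sigma : 'S_n).

Lemma shuffle_lift0 i sigma :
  shuffle i.+1 (lift_perm ord0 ord0 sigma) = shuffle i sigma.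
Proof.
apply/'forall_forallP/'forall_forallP => H a b; last first.
  case: (unliftP ord0 a) => [a'|] ->; case: (unliftP ord0 b) => [b'|] ->;
    rewrite ?lift_perm_id ?lift_perm_lift //; last by apply/implyP.
  by have := H a' b'; rewrite /bump /= ?add1n ?ltnS.
by have := H (lift ord0 a) (lift ord0 b); rewrite !lift_perm_lift /bump /=
  ?add1n ?ltnS.
Qed.

Lemma shuffle_liftS (i : 'I_n.+1) sigma :
  shuffle i (lift_perm i ord0 sigma) = shuffle i sigma.
Proof.
apply/'forall_forallP/'forall_forallP => H a b; last first.
  case: (unliftP i a) => [a'|] ->; case: (unliftP i b) => [b'|] ->;
    rewrite ?lift_perm_id ?lift_perm_lift //=.
  - simpl in a', b'; have := H a' b'; rewrite /bump !add1n ltnS.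
    case: (sigma a' < sigma b')%N; rewrite ?implybT ?implybF// => /negP K.
    apply/negP; case: (leqP i a') => ?; case: (leqP i b') => ?;
      rewrite ?add1n ?add0n; lia.
  - by rewrite /bump; case: (leqP i a') => ?; rewrite ?add1n ?add0n; lia.
  - by rewrite /bump; case: (leqP i b') => ?; rewrite ?add1n ?add0n; lia.
  - by rewrite ltnn.
have := H (lift i a) (lift i b); rewrite !lift_perm_lift /= /bump !add1n ltnS.
case: (sigma a < sigma b)%N; rewrite ?implybT ?implybF// => /negP K; apply/negP.
by move: K; case: (leqP i a) => ?; case: (leqP i b) => ?;
  rewrite ?add1n ?add0n; lia.
Qed.

(** Both blocks of a shuffle are increasing, so the smallest letter can only head one of them. *)
Lemma shuffle_lift_other i (j : 'I_n.+1) sigma :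
  (i <= n.+1)%N -> (0 < j)%N -> j != i :> nat ->
  ~~ shuffle i (lift_perm j ord0 sigma).
Proof.
move=> le_i j0 ji; apply/negP => /'forall_forallP H.
have [lt|ge] := ltnP j i.
  by have := H ord0 j; rewrite j0 lt lift_perm_id.
have lti : (i < n.+1)%N by apply: leq_ltn_trans (ltn_ord j).
have := H (Ordinal lti) j; rewrite lift_perm_id /= leqnn orbT andbT ltn0.
by rewrite ltn_neqAle eq_sym ji ge.
Qed.

Lemma sum_shuffle_lift (W : zmodType) (G : nat -> 'S_n.+1 -> W) :
  \sum_(i < n.+2) \sum_(sigma : 'S_n.+1 | shuffle i sigma) G i sigma =
  \sum_(i < n.+1) \sum_(sigma : 'S_n | shuffle i sigma)
     (G i.+1 (lift_perm ord0 ord0 sigma) + G i (lift_perm i ord0 sigma)).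
Proof.
pose A i :=
  \sum_(sigma : 'S_n | shuffle i sigma) G i.+1 (lift_perm ord0 ord0 sigma).
pose B (j : 'I_n.+1) :=
  \sum_(sigma : 'S_n | shuffle j sigma) G j (lift_perm j ord0 sigma).
(* For [i = 0] the first block is empty and place 0 heads the second one; the guard [0 < i] prevents
   counting this case twice. *)
transitivity (\sum_(i < n.+2) \sum_(j < n.+1)
    ((if (0 < i)%N && (j == ord0) then A i.-1 else 0) +
     (if i == j :> nat then B j else 0))).
  apply: eq_bigr => i _; rewrite big_mkcond sum_perm_lift.
  apply: eq_bigr => j _; rewrite -big_mkcond /=.
  case: (posnP i) => [i0|i0] /=.
    rewrite add0r; case: eqP => [ij|/eqP ij].
      by rewrite ij; apply: eq_bigl => s; rewrite shuffle_liftS.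
    have j0 : (0 < j)%N by rewrite lt0n eq_sym -i0.
    rewrite big1// => s; rewrite (negPf (shuffle_lift_other s _ j0 _))//.
      exact: (ltn_ord i).
    by rewrite eq_sym.
  case: (eqVneq j ord0) => [->|j0].
    rewrite gtn_eqF// addr0 /A; apply: eq_big => s; last by rewrite prednK.
    by rewrite -shuffle_lift0 prednK.
  rewrite add0r; case: eqP => [ij|/eqP ij].
    by rewrite ij; apply: eq_bigl => s; rewrite shuffle_liftS.
  have {}j0 : (0 < j)%N by rewrite lt0n.
  rewrite big1// => s; rewrite (negPf (shuffle_lift_other s _ j0 _))//.
    exact: (ltn_ord i).
  by rewrite eq_sym.
under eq_bigr do rewrite big_split /=.
rewrite big_split /=; under [RHS]eq_bigr do rewrite big_split /=.
rewrite big_split; congr (_ + _).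
  rewrite big_ord_recl /= big1 ?add0r//; apply: eq_bigr => i _.
  by rewrite /= -big_mkcond big_pred1_eq.
rewrite exchange_big /=; apply: eq_bigr => j _.
rewrite -big_mkcond (big_pred1 (widen_ord (leqnSn _) j))// => i.
Qed.

(** The inversions involving the first letter are those with the [j] letters now placed before
    it. *)
Lemma koszul_lift (F : fieldType) (d : int) ds (j : 'I_n.+1) sigma :
  koszul F (d :: ds) (lift_perm j ord0 sigma) =
  (\prod_(e <- take j (perm_seq 0 sigma ds)) (-1) ^+ absz (e * d)) *
  koszul F ds sigma.
Proof.
rewrite /koszul (bigD1_ord j)//= [X in X * _]big1 ?mul1r; last first.
  by move=> b; rewrite lift_perm_id ltn0 andbF.
under eq_bigr => k _ do rewrite big_mkcond (bigD1_ord j)//=.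
rewrite big_split /=; congr (_ * _).
  have st : size (take j (perm_seq 0 sigma ds)) = j.
    by rewrite size_take size_perm_seq; case: ltnP => //; have := ltn_ord j;
      lia.
  rewrite (big_nth 0) st big_mkord [RHS](big_ord_widen n (fun i =>
    (-1) ^+ absz ((take j (perm_seq 0 sigma ds))`_i * d))) ?leq_ord//.
  rewrite [RHS]big_mkcond; apply: eq_bigr => k _ /=.
  rewrite lift_perm_id lift_perm_lift /= andbT.
  have -> : (bump j k < j)%N = (k < j)%N.
    by rewrite /bump; case: (leqP j k) => ?; rewrite ?add1n ?add0n; lia.
  by case: ltnP => // kj; rewrite nth_take// nth_perm_seq.
apply: eq_bigr => k _; rewrite [RHS]big_mkcond; apply: eq_bigr => l _ /=.
rewrite !lift_perm_lift /= /bump !add1n !ltnS.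
have -> // : ((j <= k) + k < (j <= l) + l)%N = (k < l)%N.
by case: (leqP j k) => ?; case: (leqP j l) => ?; rewrite ?add1n ?add0n; lia.
Qed.

End Shuffles.

Section Splittings.
Variables (F : fieldType) (Z : Type) (deg : Z -> int).

Definition pass (z : Z) (A : seq Z) : F :=
  \prod_(a <- A) (-1) ^+ absz (deg a * deg z).

(* The sum of G A B over all ways of distributing zs into subsequences A and  *)
(* B, with the Koszul sign of the shuffle of zs into A ++ B.                  *)
Fixpoint split_sum (W : lmodType F) (zs : seq Z) (G : seq Z -> seq Z -> W) :
  W :=
  if zs is z :: zs' then
    split_sum zs' (fun A B => G (z :: A) B) +
    split_sum zs' (fun A B => pass z A *: G A (z :: B))
  else G [::] [::].

Lemma split_sumE (W : lmodType F) (z0 : Z) (n : nat) (zs : seq Z) (G :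
  seq Z -> seq Z -> W) :
  size zs = n ->
  \sum_(i < n.+1) \sum_(sigma : 'S_n | shuffle i sigma)
    koszul F (map deg zs) sigma *:
      G (take i (perm_seq z0 sigma zs)) (drop i (perm_seq z0 sigma zs)) =
  split_sum zs G.
Proof.
elim: n zs G => [|n IH] [|z zs] G //=.
  have triv (i : 'I_1) (sigma : 'S_0) : shuffle i sigma by
    apply/'forall_forallP => -[].
  move=> _; rewrite big_ord1 (big_pred1 1%g) => [|s]; last first.
    by rewrite triv; apply/esym/eqP/permP => -[].
  rewrite /koszul big_ord0 scale1r.
  by rewrite (size0nil (size_perm_seq z0 (1%g : 'S_0) [::])).
move=> [sz]; rewrite (sum_shuffle_lift (fun i sigma =>
  koszul F (deg z :: map deg zs) sigma *:
  G (take i (perm_seq z0 sigma (z :: zs))) (drop i (perm_seq z0 sigma (z ::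
    zs))))).
under eq_bigr do rewrite big_split /=.
rewrite big_split /=; congr (_ + _); rewrite -IH//; apply: eq_bigr => i _;
  apply: eq_bigr => sigma _.
  by rewrite koszul_lift perm_seq_lift /= !take0 !drop0 big_nil mul1r.
have st : size (take i (perm_seq z0 sigma zs)) = i.
  by rewrite size_take size_perm_seq; case: ltnP => //; have := ltn_ord i; lia.
rewrite koszul_lift perm_seq_lift take_cat drop_cat st ltnn subnn /= cats0
  scalerA mulrC.
by congr ((_ * _) *: _); rewrite -(map_perm_seq deg z0)// -map_take big_map.
Qed.

Lemma eq_split_sum (W : lmodType F) zs (G G' : seq Z -> seq Z -> W) :
  (forall A B, G A B = G' A B) -> split_sum zs G = split_sum zs G'.
Proof.
elim: zs G G' => [|z zs IH] G G' GG' /=; first exact: GG'.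
by congr (_ + _); apply: IH => A B; rewrite GG'.
Qed.

Lemma split_sum_linear (W W' : lmodType F) (h : {linear W -> W'}) zs
    (G : seq Z -> seq Z -> W) :
  h (split_sum zs G) = split_sum zs (fun A B => h (G A B)).
Proof.
elim: zs G => [|z zs IH] G //=; rewrite linearD !IH; congr (_ + _).
by apply: eq_split_sum => A B; rewrite linearZ.
Qed.

Lemma split_sumZ (W : lmodType F) zs a (G : seq Z -> seq Z -> W) :
  a *: split_sum zs G = split_sum zs (fun A B => a *: G A B).
Proof. exact: (split_sum_linear (a \*: idfun)). Qed.

Lemma split_sum_lin (W : lmodType F) zs a (G G' : seq Z -> seq Z -> W) :
  split_sum zs (fun A B => a *: G A B + G' A B) =
  a *: split_sum zs G + split_sum zs G'.
Proof.
elim: zs G G' => [|z zs IH] G G' //=; rewrite !IH.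
under [X in _ + X = _]eq_split_sum => A B
  do rewrite scalerDr scalerA mulrC -scalerA.
by rewrite IH; lin F.
Qed.

Lemma split_sum0 (W : lmodType F) zs : split_sum zs (fun _ _ => 0 : W) = 0.
Proof.
elim: zs => //= z zs IH; rewrite IH add0r -[RHS]IH.
by apply: eq_split_sum => A B; rewrite scaler0.
Qed.

End Splittings.

Lemma koszul_odd (F : fieldType) n (sigma : 'S_n) :
  koszul F (nseq n 1) sigma = (-1) ^+ sigma.
Proof.
move: n sigma; apply: lift_perm_ind => [|n j sigma IH].
  by rewrite /koszul big_ord0 odd_perm1.
rewrite [nseq _ _]/= koszul_lift IH odd_lift_perm addbF signr_addb signr_odd.
congr (_ * _); have -> : perm_seq 0 sigma (nseq n 1) = nseq n (1 : int).
  apply: (@eq_from_nth _ 0) => [|i]; first by rewrite size_perm_seq size_nseq.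
  rewrite size_perm_seq => ltin; rewrite (nth_perm_seq _ _ _ (Ordinal ltin)).
  by rewrite !nth_nseq ltn_ord ltin.
rewrite take_nseq ?leq_ord// big_nseq mulr1 expr1.
by elim: (val j) => //= k ->; rewrite exprS.
Qed.

(** Reindexing by [m = q + k], the place of the last argument of the inserted map, which the
    shuffles leave fixed. *)
Lemma sum_triangle (W : zmodType) n (H : nat -> nat -> W) :
  \sum_(q < n) \sum_(k < (n - q.+1).+1) H q k =
  \sum_(m < n) \sum_(k < m.+1) H (m - k)%N k.
Proof.
transitivity (\sum_(q < n) \sum_(k < n | (k < n - q)%N) H q k).
  apply: eq_bigr => q _; have -> : (n - q.+1).+1 = (n - q)%N.
    by have := ltn_ord q; lia.
  by rewrite (big_ord_widen n (H q)) ?leq_subr.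
transitivity (\sum_(m < n) \sum_(k < n | (k < m.+1)%N) H (m - k)%N k);
  last first.
  by apply: eq_bigr => m _; rewrite -(big_ord_widen n (fun k => H (m - k)%N k)).
rewrite (exchange_big_dep predT)// [RHS](exchange_big_dep predT)//=.
apply: eq_bigr => k _.
transitivity (\sum_(0 <= q < n - k) H q k).
  rewrite big_mkord (big_ord_widen n (H ^~ k)) ?leq_subr//; apply: eq_bigl => q.
  by have := ltn_ord q; lia.
rewrite -(big_geq_mkord k n xpredT (fun m => H (m - k)%N k)).
have := big_addn 0 n k xpredT (fun m => H (m - k)%N k); rewrite add0n => ->.
by apply: eq_bigr => q _; rewrite addnK.
Qed.

(** * Comparison of the shuffle formula for the bracket with [bal] *)

Section InsertBridge.
Variables (F : fieldType) (E : lmodType F).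
Implicit Types f g : seq E -> E.

Lemma perm_seq_take (T : Type) (x0 : T) n (sigma : 'S_n) m s : (n <= m)%N ->
  perm_seq x0 sigma (take m s) = perm_seq x0 sigma s.
Proof.
move=> nm; rewrite /perm_seq; apply: eq_map => i.
by rewrite nth_take// (leq_trans (ltn_ord _)).
Qed.

(* The shuffles in the Balavoine bracket carry the plain sign of the          *)
(* permutation, which is the Koszul sign for letters of odd degree.           *)
Definition odd_deg (x : E) : int := 1.

(** With the last argument of [g] fixed at place [m], the letters before it are distributed into
    those outside [g] and those inside. *)
Lemma sum_insert f g s m : (m < size s)%N ->
  \sum_(k < m.+1) insert (m - k) k f g s =
  split_sum odd_deg (take m s) (fun A B => (-1) ^+ (size A * size B) *:
    f (A ++ g (rcons B s`_m) :: drop m.+1 s)).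
Proof.
move=> ms; have sm : size (take m s) = m by rewrite size_takel// ltnW.
rewrite -(split_sumE _ 0 _ sm).
apply: eq_bigr => k _.
have km : (k + (m - k))%N = m by rewrite subnKC ?leq_ord.
(* The size occurs in the type of the permutations, so it is generalised before being replaced by
   [m]. *)
have insE N : (k + (m - k))%N = N -> insert (m - k) k f g s =
    \sum_(sigma : 'S_N | shuffle k sigma)
      ((-1) ^+ (k * (m - k)) * (-1) ^+ sigma) *:
      f (take k (permute sigma s)
         ++ g (rcons (drop k (permute sigma s)) s`_N) :: drop N.+1 s).
  by move=> <-.
rewrite (insE m km); apply: eq_bigr => sigma _.
have -> : [seq odd_deg i | i <- take m s] = nseq m 1.
  apply: (@eq_from_nth _ 0) => [|i]; rewrite size_map sm ?size_nseq// => im.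
  by rewrite (nth_map 0) ?sm// nth_nseq im.
rewrite koszul_odd perm_seq_take// scalerA mulrC -[permute sigma s]/(perm_seq 0
  sigma s).
rewrite size_take size_drop size_perm_seq.
suff -> : (if (k < m)%N then val k else m) = k by [].
by case: ltnP => // mk; apply/eqP; rewrite eqn_leq mk leq_ord.
Qed.

(** The term [m = 0] has [x] as the only argument of [g]; in the others [x] joins [A] or [B]. These
    are the three summands of [ins]: the sign (-1)^(size A * size B) produces the twist in the first
    case and absorbs [pass] in the second. *)
Lemma sum_split_ins f g s : multilinear f ->
  \sum_(m < size s) split_sum odd_deg (take m s)
    (fun A B => (-1) ^+ (size A * size B) *:
      f (A ++ g (rcons B s`_m) :: drop m.+1 s)) = ins s g f.
Proof.
elim: s f g => [|x s IH] f g fm /=; first by rewrite big_ord0.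
rewrite big_ord_recl /= scale1r addrC; congr (_ + _); last by rewrite drop0.
rewrite big_split /= -!IH//; last exact: multilinear_lpart.
congr (_ + _); apply: eq_bigr => m _; apply: eq_split_sum => A B.
  rewrite /twist /rescale size_rcons (multilinearZ _ _ _ _ (multilinear_lpart x
    fm)).
  rewrite scalerA -exprD /= mulSn -signr_odd -[in RHS]signr_odd.
  by congr (_ ^+ _ *: _); rewrite !oddD /= negbK addbC.
rewrite scalerA /pass; congr (_ *: _).
have -> : \prod_(a <- A) (-1) ^+ absz (odd_deg a * odd_deg x) = (-1) ^+ size A
  :> F.
  by elim: A => [|a A IHA]; rewrite ?big_nil// big_cons IHA /odd_deg mulr1
    -exprS.
by rewrite /= mulnS exprD signrMK.
Qed.

Lemma sum_barcomp f g s : multilinear f ->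
  \sum_(q < size s) barcomp (size s - q.+1) q f g s = ins s g f.
Proof.
move=> fm; rewrite (sum_triangle _ (fun q k => insert q k f g s))
  -sum_split_ins//.
by apply: eq_bigr => m _; rewrite sum_insert.
Qed.

Lemma barcomp_inner0 p q f g s : multilinear f ->
  (forall t, size t = q.+1 -> g t = 0) -> barcomp p q f g s = 0.
Proof.
move=> fm g0; rewrite /barcomp big1// => k _; rewrite /insert big1// => sigma _.
rewrite g0 ?multilinear0 ?scaler0// size_rcons size_drop.
by rewrite -[permute sigma s]/(perm_seq 0 sigma s) size_perm_seq addKn.
Qed.

Lemma barcomp_outer0 p q f g s : size s = (p + q).+1 ->
  (forall t, size t = p.+1 -> f t = 0) -> barcomp p q f g s = 0.
Proof.
move=> ss f0; rewrite /barcomp big1// => k _; rewrite /insert big1// => sigma _.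
rewrite f0 ?scaler0// size_cat size_take /= size_drop ss.
rewrite -[permute sigma s]/(perm_seq 0 sigma s) size_perm_seq.
by case: ltnP => ?; have := ltn_ord k; lia.
Qed.

Lemma balavoineE b c f g : multilinear f -> multilinear g ->
  parity b f -> parity c g -> balavoine f g = bal f g.
Proof.
move=> fm gm fb gc; apply/funext => s; rewrite (balE fm gm fb gc).
rewrite -[RHS]/(ins s g f - sg F (b && c) *: ins s f g) -!sum_barcomp//.
rewrite /balavoine big_split /=; congr (_ + _).
(* Reversing the order of summation exchanges [p] and [q]. *)
rewrite sumrN; congr (- _); rewrite [in RHS](reindex_inj rev_ord_inj)
  scaler_sumr.
apply: eq_bigr => q _ /=; have lq := ltn_ord q.
have -> : (size s - (size s - q.+1).+1)%N = q by lia.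
have ss : size s = (q + (size s - q.+1)).+1 by lia.
(* Summands whose degrees have the wrong parity vanish, so the sign depends on [b] and [c] alone. *)
case: (eqVneq (odd (size s - q.+1)) b) => pb; last first.
  rewrite barcomp_inner0 ?scaler0// => t st; apply: fb.
  by rewrite st /=; move: pb; case: (odd _) b => [] [].
case: (eqVneq (odd q) c) => qc; last first.
  rewrite barcomp_outer0 ?scaler0// => t st; apply: gc.
  by rewrite st /=; move: qc; case: (odd _) c => [] [].
by rewrite -signr_odd oddM pb qc.
Qed.

End InsertBridge.

(** * The subspaces L' and hh, and the projection *)

Section Bounded.
Variables (F : fieldType).
Implicit Types U W : lmodType F.

(** The value of [g] takes one argument place of [f], so in each term the two arities add up to
    [size s + 1]. Bounds and degrees of insertions both follow from this. *)
Lemma ins_size0 U W (s : seq U) g (f : seq U -> W) : multilinear f ->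
    (forall t u, size t + size u = (size s).+1 ->
       (0 < size t)%N -> (0 < size u)%N -> g t = 0 \/ f u = 0) ->
  ins s g f = 0.
Proof.
elim: s g f => //= x s IH g f fm gf0.
rewrite !IH ?add0r//; first by case: (gf0 [:: x] (g [:: x] :: s)) => //= ->;
  rewrite multilinear_cons0.
- by move=> t u tu t0 u0; apply: (gf0 (x :: t) u) => //=; lia.
- exact: multilinear_lpart.
- move=> t u tu t0 u0; case: (gf0 t (x :: u)) => //=; first by lia.
    by move=> gt; left; rewrite /twist /rescale gt scaler0.
  by right.
Qed.

Lemma bounded_arity_ins U W g (f : seq U -> W) : multilinear f ->
  bounded_arity g -> bounded_arity f -> bounded_arity (insf g f).
Proof.
move=> fm [N gN] [M fM]; exists (N + M)%N => s lts.
apply: ins_size0 => // t u tu _ _.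
by have [/fM|uM] := ltnP M (size u); [right|left; apply: gN; lia].
Qed.

Lemma bounded_arity_rescale c U W (f : seq U -> W) :
  bounded_arity f -> bounded_arity (rescale c f).
Proof. by case=> N fN; exists N => s /fN; rewrite /rescale => ->;
  rewrite scaler0. Qed.

Lemma bounded_arity_lin U W (f f' : seq U -> W) a :
  bounded_arity f -> bounded_arity f' -> bounded_arity (a *: f + f').
Proof.
move=> [N fN] [M fM]; exists (maxn N M) => s; rewrite gtn_max => /andP[sN sM].
by rewrite !fctE fN// fM// scaler0 addr0.
Qed.

Lemma bounded_arity_bal (E : lmodType F) (f g : seq E -> E) :
  multilinear f -> multilinear g -> bounded_arity f -> bounded_arity g ->
  bounded_arity (bal f g).
Proof.
move=> fm gm fb gb; rewrite /bal -addrA -opprD addrC -scaleN1r.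
apply: bounded_arity_lin; last exact: bounded_arity_ins.
rewrite -[X in X + _]scale1r; apply: bounded_arity_lin.
  by apply: bounded_arity_ins => //; apply: bounded_arity_rescale.
apply: bounded_arity_ins; first exact: multilinear_rescale.
  exact: bounded_arity_rescale.
exact: bounded_arity_rescale.
Qed.

Lemma has_degree_ins (E : lmodType F) (p q : int) (f g : seq E -> E) :
  multilinear f -> has_degree p f -> has_degree q g ->
  has_degree (p + q) (insf g f).
Proof.
move=> fm fp gq s spq; apply: ins_size0 => // t u tu _ _.
case: (eqVneq (size t)%:Z (q + 1)) => [tq|/gq]; last by left.
by right; apply: fp; apply: contraNneq spq => up; lia.
Qed.

Lemma has_degree_lin (E : lmodType F) (p : int) (f g : seq E -> E) a :
  has_degree p f -> has_degree p g -> has_degree p (a *: f + g).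
Proof. by move=> fp gp s sp; rewrite !fctE fp// gp// scaler0 addr0. Qed.

Lemma has_degree_rescale (E : lmodType F) c p (f : seq E -> E) :
  has_degree p f -> has_degree p (rescale c f).
Proof. by move=> fp s sp; rewrite /rescale fp// scaler0. Qed.

Lemma has_degree_bal (E : lmodType F) (p q : int) (f g : seq E -> E) :
  multilinear f -> multilinear g -> has_degree p f -> has_degree q g ->
  has_degree (p + q) (bal f g).
Proof.
move=> fm gm fb gb; rewrite /bal -addrA -opprD [insf g f + _]addrC -scaleN1r.
apply: has_degree_lin; last exact: has_degree_ins.
rewrite -[insf (even_part f) g]scale1r; apply: has_degree_lin; rewrite addrC.
  by apply: has_degree_ins => //; apply: has_degree_rescale.
apply: has_degree_ins; first exact: multilinear_rescale.
  exact: has_degree_rescale.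
exact: has_degree_rescale.
Qed.

Lemma has_degree_parity (E : lmodType F) (n : nat) (f : seq E -> E) :
  has_degree n f -> parity (odd n) f.
Proof.
move=> fn s sn; apply: fn; apply/eqP => e.
have {e} e : size s = n.+1 by lia.
by move: sn; rewrite e /=; case: odd.
Qed.

End Bounded.

Section Alternating.
Variables (F : fieldType) (U W : lmodType F) (h : seq U -> W).

Lemma alternating_swap : multilinear h -> alternating h ->
  forall u x y v, h (u ++ x :: y :: v) + h (u ++ y :: x :: v) = 0.
Proof.
move=> hm ha u x y v.
have z0 z : h (u ++ z :: z :: v) = 0.
  by apply: ha; rewrite cat_uniq /= mem_head !andbF.
have hD u' v' a b : h (u' ++ (a + b) :: v') = h (u' ++ a ::
  v') + h (u' ++ b :: v').
  by rewrite -[a in LHS]scale1r hm scale1r.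
have := z0 (x + y); rewrite hD.
have e a b c : u ++ a :: b :: c = rcons u a ++ b :: c by rewrite cat_rcons.
by rewrite !e !hD -!e !z0 add0r addr0.
Qed.

(** Swaps bring two equal arguments side by side; then twice the value is zero, and 2 is invertible
    in characteristic 0. *)
Lemma alternating_of_swap : [pchar F] =i pred0 ->
  (forall u x y v, h (u ++ x :: y :: v) + h (u ++ y :: x :: v) = 0) ->
  alternating h.
Proof.
move=> char0 hs.
have dup u x v w : h (u ++ x :: v ++ x :: w) = 0.
  elim: v u => [|z v IH] u /=.
    have := hs u x x w; rewrite -mulr2n -scaler_nat => /eqP.
    rewrite scaler_eq0 => /orP[|/eqP//].
    by have := char0 2; rewrite !inE /= => ->.
  by have := hs u x z (v ++ x :: w); rewrite -(cat_rcons z u) IH addr0.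
move=> s; rewrite -[s in h s]cat0s; elim: s [::] => //= x s IH u.
rewrite negb_and negbK => /orP[xs|us]; last by rewrite -cat_rcons IH.
by case/splitPr: xs => v w; apply: dup.
Qed.

End Alternating.

(** * Closure of L' under the bracket *)

Section LprimeClosure.
Variables (F : fieldType) (char0 : [pchar F] =i pred0) (g V : lmodType F).
Local Notation E := (g * V)%type.
Implicit Types f h : seq E -> E.

(* On the diagonal: (f s).1 only depends on the g-components of s, and        *)
(* (f s).2 on those of all arguments but the last and the V-component of the  *)
(* last.                                                                      *)
(* The relational form is what an induction over [ins] needs.                 *)
Definition lrel f f' :=
  (forall s s', map fst s = map fst s' -> (f s).1 = (f' s').1) /\
  (forall s s' x x', map fst s = map fst s' -> x.2 = x'.2 ->
     (f (rcons s x)).2 = (f' (rcons s' x')).2).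

(** The [V]-component need not change sign when the last argument takes part in the swap, since that
    one ranges over [V]; hence the condition on [s]. *)
Definition lswap f := forall u x y s,
  (f (u ++ x :: y :: s) + f (u ++ y :: x :: s)).1 = 0 /\
  (s != [::] -> f (u ++ x :: y :: s) + f (u ++ y :: x :: s) = 0).

Lemma ext_sum1 (alpha : seq g -> g) (beta : seq g -> V -> V) s :
  ((ext_g alpha \+ ext_gV beta) s).1 = alpha (map fst s).
Proof. by rewrite /ext_g /ext_gV /=; case: s => [|x s]; apply: addr0. Qed.

Lemma ext_sum2 (alpha : seq g -> g) (beta : seq g -> V -> V) s x :
  ((ext_g alpha \+ ext_gV beta) (rcons s x)).2 = beta (map fst s) x.2.
Proof.
rewrite /ext_g /ext_gV; case: s => [|y s]; first exact: add0r.
by rewrite rcons_cons /= belast_rcons last_rcons; apply: add0r.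
Qed.

Lemma ext_sum0 (alpha : seq g -> g) (beta : seq g -> V -> V) :
  alpha [::] = 0 -> (ext_g alpha \+ ext_gV beta) [::] = 0.
Proof. by rewrite /ext_g /ext_gV /= => ->; apply: addr0. Qed.

Lemma map_fst_cons0 (s : seq g) : map fst [seq (x, 0 : V) | x <- s] = s.
Proof. by rewrite -map_comp map_id. Qed.

Lemma pair_eqE (a b : E) : a.1 = b.1 -> a.2 = b.2 -> a = b.
Proof. by case: a b => [a1 a2] [b1 b2] /= -> ->. Qed.

(** An intrinsic description of L', with no components to exhibit. Together these conditions pass to
    insertions; characteristic 0 enters in the converse, to recover alternating maps. *)
Lemma Lprime_propP f : Lprime_prop f <->
  [/\ f [::] = 0, multilinear f, bounded_arity f, lrel f f & lswap f].
Proof.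
split.
  case=> alpha [beta [[a0 am aa [N aN]] [bm bl ba [M bM]] ->]].
  set f' := ext_g alpha \+ ext_gV beta.
  have f0 : f' [::] = 0 by apply: ext_sum0.
  split=> //.
  - move=> s t a x y; apply: pair_eqE.
      by rewrite -[RHS]/(a *: (f' _).1 + (f' _).1) !ext_sum1 !map_cat /= am.
    rewrite -[RHS]/(a *: (f' _).2 + (f' _).2).
    case/lastP: t => [|t z]; first by rewrite !cats1 !ext_sum2 bl.
    by rewrite -!rcons_cons -!rcons_cat !ext_sum2 !map_cat /= (bm z.2).
  - exists (maxn N M.+1) => s; rewrite gtn_max => /andP[sN].
    case/lastP: s sN => // s x sN; rewrite size_rcons ltnS => sM.
    apply: pair_eqE; first by rewrite ext_sum1 aN// size_map.
    by rewrite ext_sum2 bM// size_map.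
  - split=> [s s' ss|s s' x x' ss xx]; first by rewrite !ext_sum1 ss.
    by rewrite !ext_sum2 ss xx.
  - have H1 u x y s : (f' (u ++ x :: y :: s) + f' (u ++ y :: x :: s)).1 = 0.
      rewrite -[LHS]/((f' _).1 + (f' _).1) !ext_sum1 !map_cat.
      exact: alternating_swap.
    move=> u x y s; split=> // s0; apply: pair_eqE; first exact: H1.
    case/lastP: s s0 => // s z _; rewrite -[LHS]/((f' _).2 + (f' _).2).
    rewrite -!rcons_cons -!rcons_cat !ext_sum2 !map_cat.
    exact: (alternating_swap (bm z.2) (ba z.2)).
case=> f0 fm [N fN] [fr1 fr2] fs.
(* Both components are read off on arguments [(x, 0)], with a last argument [(0, v)] for the
   second. *)
exists (fun t => (f [seq (x, 0) | x <- t]).1).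
exists (fun t v => (f (rcons [seq (x, 0) | x <- t] (0, v))).2).
have pairD a x y : (a *: x + y, 0) = a *: (x, 0) + (y, 0) :> E.
  by apply: pair_eqE => //=; rewrite scaler0 addr0.
split.
- split.
  + by rewrite /= f0.
  + by move=> s t a x y; rewrite !map_cat /= pairD fm.
  + apply: alternating_of_swap => // u x y v; rewrite !map_cat /=.
    by have [] := fs [seq (x, 0) | x <- u] (x, 0) (y, 0) [seq (x, 0) | x <- v].
  + by exists N => s sN; rewrite fN// size_map.
- split.
  + move=> v s t a x y; rewrite !map_cat /= pairD.
    by rewrite -!cats1 -!catA !cat_cons fm.
  + move=> s a v w; rewrite -!cats1.
    have -> : (0, a *: v + w) = a *: (0, v) + (0, w) :> E.
      by apply: pair_eqE => //=; rewrite scaler0 addr0.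
    by rewrite fm.
  + move=> v; apply: alternating_of_swap => // u x y t; rewrite !map_cat /=.
    have [_] := fs [seq (x, 0) | x <- u] (x, 0) (y, 0) (rcons [seq (x,
      0) | x <- t] (0, v)).
    rewrite -!cats1 -!catA !cat_cons => H.
    have {H} := H _; by rewrite -size_eq0 size_cat addn1 =>
      /(_ isT) /(congr1 snd).
  + by exists N => s v sN; rewrite fN// size_rcons size_map ltnW// ltnS.
- apply/funext => s; apply: pair_eqE.
    by rewrite ext_sum1; apply: fr1; rewrite map_fst_cons0.
  case/lastP: s => [|s x]; first by rewrite f0 ext_sum0//= f0.
  by rewrite ext_sum2; apply: fr2 => //; rewrite map_fst_cons0.
Qed.

Lemma lrel_lpart f f' x x' : x.1 = x'.1 -> lrel f f' ->
  lrel (lpart x f) (lpart x' f').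
Proof.
move=> xx [f1 f2]; split=> [s s' ss|s s' y y' ss yy].
  by apply: f1; rewrite /= xx ss.
by apply: (f2 (x :: s) (x' :: s')) => //; rewrite /= xx ss.
Qed.

Lemma lrel_rescale c f f' : lrel f f' -> lrel (rescale c f) (rescale c f').
Proof.
move=> [f1 f2]; split=> [s s' ss|s s' y y' ss yy]; rewrite /rescale.
  by rewrite -(size_map fst s) -(size_map fst s') ss /= (f1 s s').
rewrite !size_rcons -(size_map fst s) -(size_map fst s') ss.
rewrite -[LHS]/(_ *: (f (rcons s y)).2) -[RHS]/(_ *: (f' (rcons s' y')).2).
by rewrite (f2 _ _ _ _ ss yy).
Qed.

(** Heads [x] and [x'] may differ in their [V]-components, so the recursion compares different maps
    [lpart x f] and [lpart x' f']. The new heads [h [:: x]] and [h' [:: x']] again agree in [g],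
    which is all that [lrel] asks of a head. *)
Lemma lrel_ins f f' h h' : lrel f f' -> lrel h h' ->
  lrel (insf h f) (insf h' f').
Proof.
move=> fr hr; split=> s.
  elim: s f f' h h' fr hr => [|x s IH] f f' h h' fr hr [|x' s'] //= [xx ss].
  congr (_ + _ + _).
  - by apply: IH => //; [apply: lrel_lpart|apply: lrel_rescale].
  - by apply: IH => //; apply: lrel_lpart.
  - by apply: (fr.1); rewrite /= ss (hr.1 [:: x] [:: x'])//= xx.
elim: s f f' h h' fr hr => [|x s IH] f f' h h' fr hr [|x' s'] y y' //=.
  move=> _ yy; rewrite /insf /= !add0r.
  by apply: (fr.2 [::] [::]) => //; apply: (hr.2 [::] [::]).
move=> [xx ss] yy; congr (_ + _ + _).
- by apply: IH => //; [apply: lrel_lpart|apply: lrel_rescale].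
- by apply: IH => //; apply: lrel_lpart.
- by apply: (fr.2 (_ :: s) (_ :: s')); rewrite //= ss (hr.1 [:: x] [::
  x'])//= xx.
Qed.

Lemma lswap_lpart f x : lswap f -> lswap (lpart x f).
Proof. by move=> fs u y z s; apply: (fs (x :: u)). Qed.

Lemma lswap_rescale c f : lswap f -> lswap (rescale c f).
Proof.
move=> fs u x y s; have [f1 f2] := fs u x y s.
have -> : rescale c f (u ++ [:: x, y & s]) + rescale c f (u ++ [:: y, x & s]) =
    c (size u + (size s).+2)%N *: (f (u ++ x :: y :: s) + f (u ++ y :: x :: s)).
  by rewrite /rescale !size_cat scalerDr.
split; last by move=> s0; rewrite f2// scaler0.
by rewrite -[LHS]/(_ *: (f _ + f _).1) f1 scaler0.
Qed.

(** Terms with one of [x], [y] outside [h] and the other inside before its last argument cancel,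
    because twisting anticommutes with [lpart]. *)
Lemma insf_swap (W : lmodType F) (f h : seq W -> W) x y s :
  multilinear f -> multilinear h ->
  insf h f (x :: y :: s) + insf h f (y :: x :: s) =
  ins s h (lpart y (lpart x f) + lpart x (lpart y f)) +
  ins s (lpart y (lpart x h) + lpart x (lpart y h)) f +
  f (h [:: x; y] + h [:: y; x] :: s) +
  (f (x :: h [:: y] :: s) + f (h [:: y] :: x :: s)) +
  (f (y :: h [:: x] :: s) + f (h [:: x] :: y :: s)).
Proof.
move=> fm hm; rewrite /insf /=.
have -> : twist (twist h) = h.
  apply/funext => t; rewrite /twist /rescale scalerA -exprD addnn.
  by rewrite -signr_odd odd_double scale1r.
have tw1 z : twist h [:: z] = h [:: z].
  by rewrite /twist /rescale /= -signr_odd /= scale1r.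
have twl z : twist (lpart z h) = - 1 *: lpart z (twist h).
  apply/funext => t; rewrite /twist /rescale /lpart !fctE /= scalerA.
  by rewrite [in RHS]exprS mulrA mulrN1 opprK mul1r.
rewrite !twl !tw1 !ins_scale_inner; do ?exact: multilinear_lpart.
rewrite ins_outerD ins_innerD// -[h [:: x; y]]scale1r multilinear_cons//
  !scale1r.
by rewrite /lpart; lin F.
Qed.

Lemma lswap_ins f h : multilinear f -> multilinear h -> lrel f f -> lrel h h ->
  lswap f -> lswap h -> lswap (insf h f).
Proof.
move=> fm hm fr hr fs hs u.
elim: u f h fm hm fr hr fs hs => [|z u IH] f h fm hm fr hr fs hs x y s;
  last first.
  have A1 := IH (lpart z f) (twist h) (multilinear_lpart z fm)
    (multilinear_rescale _ hm) (lrel_lpart erefl fr) (lrel_rescale _ hr)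
    (lswap_lpart z fs) (lswap_rescale _ hs) x y s.
  have A2 := IH f (lpart z h) fm (multilinear_lpart z hm) fr
    (lrel_lpart erefl hr) fs (lswap_lpart z hs) x y s.
  have A3 := lswap_lpart (h [:: z]) fs u x y s.
  have e : insf h f ((z :: u) ++ [:: x, y & s]) + insf h f ((z :: u) ++ [:: y,
    x & s]) =
     (insf (twist h) (lpart z f) (u ++ [:: x, y & s]) + insf (twist h) (lpart z
       f) (u ++ [:: y, x & s])) +
     (insf (lpart z h) f (u ++ [:: x, y & s]) + insf (lpart z h) f (u ++ [::
       y, x & s])) +
     (lpart (h [:: z]) f (u ++ [:: x, y & s]) + lpart (h [:: z]) f (u ++ [::
       y, x & s])).
    by rewrite /insf /lpart /=; lin F.
  rewrite e; split; last by move=> s0; rewrite A1.2// A2.2// A3.2// !addr0.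
  rewrite -[LHS]/((insf _ _ _ + insf _ _ _).1 + (insf _ _ _ + insf _ _ _).1 +
    (lpart _ _ _ + lpart _ _ _).1).
  by rewrite A1.1 A2.1 A3.1 !addr0.
rewrite !cat0s insf_swap//.
have -> : ins s h (lpart y (lpart x f) + lpart x (lpart y f)) = 0.
  rewrite -[RHS](ins_outer0 _ s h); apply: eq_ins => // z t.
  exact: (fs [::] x y (z :: t)).2.
have -> : ins s (lpart y (lpart x h) + lpart x (lpart y h)) f = 0.
  rewrite -[RHS](ins_inner0 s fm); apply: eq_ins => // z t.
  exact: (hs [::] x y (z :: t)).2.
have [f1 f2] := fs [::] x (h [:: y]) s; have [f3 f4] := fs [::] y (h [:: x]) s.
set k := _ + _ in f1.
(* Here the swap reaches the last argument of [h], so only the [g]-component vanishes. That is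
   enough, since [lrel] lets the head of [f] be replaced by 0. *)
have k1 t : map fst (h [:: x; y] + h [:: y; x] :: t) = map fst (0 :: t).
  by congr (_ :: _); have [] := hs [::] x y [::].
split=> [|s0].
  rewrite -[LHS]/((0 : g) + 0 + (f (_ :: s)).1 + (_ + _).1 + (_ + _).1) f1 f3.
  by rewrite (fr.1 _ _ (k1 s)) multilinear_cons0 ?addr0.
rewrite f2// f4// !addr0 add0r.
apply: pair_eqE; first by rewrite (fr.1 _ _ (k1 s)) multilinear_cons0.
case/lastP: s s0 {f1 f2 f3 f4 k} => // s z _.
by rewrite -rcons_cons (fr.2 _ _ _ _ (k1 s) erefl) rcons_cons multilinear_cons0.
Qed.

Lemma Lprime_prop_ins f h : Lprime_prop f -> Lprime_prop h ->
  Lprime_prop (insf h f).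
Proof.
move=> /Lprime_propP[f0 fm fb fr fs] /Lprime_propP[h0 hm hb hr hs].
apply/Lprime_propP; split.
- by [].
- exact: multilinear_ins.
- exact: bounded_arity_ins.
- exact: lrel_ins.
- exact: lswap_ins.
Qed.

Lemma Lprime_prop_rescale c f : Lprime_prop f -> Lprime_prop (rescale c f).
Proof.
move=> /Lprime_propP[f0 fm fb fr fs]; apply/Lprime_propP; split.
- by rewrite /rescale f0 scaler0.
- exact: multilinear_rescale.
- exact: bounded_arity_rescale.
- exact: lrel_rescale.
- exact: lswap_rescale.
Qed.

Lemma Lprime_prop_lin f h a : Lprime_prop f -> Lprime_prop h ->
  Lprime_prop (a *: f + h).
Proof.
move=> fL hL; apply/asboolP; have [_] := @Lprime_submod_closed F g V; apply.
  exact/asboolP.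
exact/asboolP.
Qed.

Lemma Lprime_prop_bal f h : Lprime_prop f -> Lprime_prop h ->
  Lprime_prop (bal f h).
Proof.
move=> fL hL; rewrite /bal -addrA -opprD addrC -scaleN1r.
apply: Lprime_prop_lin; last exact: Lprime_prop_ins.
rewrite -[insf (even_part f) h]scale1r; apply: Lprime_prop_lin.
  by apply: Lprime_prop_ins => //; apply: Lprime_prop_rescale.
by apply: Lprime_prop_ins; apply: Lprime_prop_rescale.
Qed.

End LprimeClosure.

(** * The projection onto [hh], its kernel and the bracket *)

Section Projection.
Variables (F : fieldType) (g V : lmodType F).
Local Notation E := (g * V)%type.
Implicit Types f h : seq E -> E.

Definition onV (s : seq V) : seq E := [seq (0, v) | v <- s].

Lemma onV_cat s t : onV (s ++ t) = onV s ++ onV t.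
Proof. exact: map_cat. Qed.

Lemma onVK s : map snd (onV s) = s.
Proof. by rewrite -map_comp map_id. Qed.

Lemma proj_ext (theta : seq V -> g) : proj_hh (ext_V theta) = ext_V theta.
Proof.
apply/funext => s; rewrite /proj_hh /ext_V -[[seq (0, v) | v <- _]]/(onV _).
by rewrite onVK.
Qed.

Lemma onV_lin a x y : (0, a *: x + y) = a *: (0, x) + (0, y) :> E.
Proof. by apply: pair_eqE => //=; rewrite scaler0 addr0. Qed.

Lemma hh_prop_proj f : f [::] = 0 -> multilinear f -> bounded_arity f ->
  hh_prop (proj_hh f).
Proof.
move=> f0 fm [N fN]; exists (fun s => (f (onV s)).1); split.
- by rewrite /= f0.
- by move=> s t a x y; rewrite !onV_cat /= onV_lin fm.
- by exists N => s sN; rewrite fN// size_map.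
- by [].
Qed.

Lemma hh_propP f : hh_prop f -> [/\ f [::] = 0, multilinear f, bounded_arity f &
  proj_hh f = f].
Proof.
case=> theta [t0 tm [N tN] ->]; rewrite /ext_V; split.
- by rewrite /= t0.
- move=> s t a x y; apply: pair_eqE; first by rewrite !map_cat /= tm.
  by rewrite /= scaler0 addr0.
- by exists N => s sN; rewrite tN// size_map.
- exact: proj_ext.
Qed.

Lemma proj_lin f h a : proj_hh (a *: f + h) = a *: proj_hh f + proj_hh h.
Proof.
apply/funext => s; apply: pair_eqE => //.
by rewrite -[RHS]/(a *: 0 + 0 : V) scaler0 addr0.
Qed.

Lemma proj_fst f s : (proj_hh f s).1 = (f (onV (map snd s))).1.
Proof. by []. Qed.

Lemma parity_proj b f : parity b f -> parity b (proj_hh f).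
Proof. by move=> fb s sb; rewrite /proj_hh /ext_V fb// !size_map. Qed.

Lemma has_degree_proj p f : has_degree p f -> has_degree p (proj_hh f).
Proof. by move=> fb s sb; rewrite /proj_hh /ext_V fb// !size_map. Qed.

(* Maps V (x) ... (x) V -> g cannot be composed. *)
Lemma ins_hh0 (W : lmodType F) h (f : seq E -> W) s :
    (forall x t, (h (x :: t)).2 = 0) ->
    (forall u z t, f (u ++ (z, 0) :: t) = 0) ->
  ins s h f = 0.
Proof.
elim: s h f => //= x s IH h f h0 f0; rewrite !IH//.
- have -> : h [:: x] = ((h [:: x]).1, 0) by apply: pair_eqE; rewrite ?h0.
  by rewrite (f0 [::]) !addr0.
- by move=> y t; apply: (h0 x).
- by move=> y t; rewrite /twist /rescale -[LHS]/(_ *: (h _).2) h0 scaler0.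
- by move=> u z t; apply: (f0 (x :: u)).
Qed.

Lemma ext_V_g0 f u z t : multilinear f -> proj_hh f (u ++ (z, 0) :: t) = 0.
Proof.
move=> fm; rewrite /proj_hh /ext_V !map_cat /= multilinear0//.
Qed.

Lemma insf_hh0 f h : hh_prop f -> hh_prop h -> insf h f = 0.
Proof.
move=> /hh_propP[_ fm _ fP] /hh_propP[_ hm _ hP]; apply/funext => s.
by apply: ins_hh0 => [x t|u z t]; [rewrite -hP|rewrite -fP ext_V_g0].
Qed.

(** On arguments from [V] the map [h] takes values in [V], so [f] too only meets arguments from
    [V]. *)
Lemma ins_ker f h s : (forall s, (f (onV s)).1 = 0) -> (forall s,
  (h (onV s)).1 = 0) ->
  (ins (onV s) h f).1 = 0.
Proof.
elim: s f h => //= x s IH f h f0 h0.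
rewrite -[LHS]/((ins _ _ _).1 + (ins _ _ _).1 + (f _).1) !IH//.
- have -> : h [:: (0, x)] = (0, (h [:: (0, x)]).2).
    by apply: pair_eqE; rewrite //= (h0 [:: x]).
  by rewrite (f0 (_ :: s)) !addr0.
- by move=> t; apply: (h0 (x :: t)).
- by move=> t; apply: (f0 (x :: t)).
- by move=> t; rewrite /twist /rescale -[LHS]/(_ *: (h _).1) h0 scaler0.
Qed.

(** The condition behind derived brackets. Split each map into its projection and a remainder: the
    two projections have zero bracket, and the bracket of the two remainders is killed by
    [proj_hh]. *)
Lemma proj_bal b c f h : multilinear f -> multilinear h ->
    f [::] = 0 -> h [::] = 0 -> bounded_arity f -> bounded_arity h ->
    parity b f -> parity c h ->
  proj_hh (bal f h) = proj_hh (bal (proj_hh f) h) + proj_hh (bal f (proj_hh h)).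
Proof.
move=> fm hm f0 h0 fN hN fb hc.
have fH := hh_prop_proj f0 fm fN; have hH := hh_prop_proj h0 hm hN.
have [_ f'm _ _] := hh_propP fH; have [_ h'm _ _] := hh_propP hH.
have f'b := parity_proj fb; have h'c := parity_proj hc.
have linN (f1 f2 : seq E -> E) : multilinear f1 -> multilinear f2 ->
  multilinear (f1 - f2).
  by move=> m1 m2; rewrite addrC -scaleN1r; apply: multilinear_lin.
have z : bal (proj_hh f) (proj_hh h) = 0.
  by rewrite (balE f'm h'm f'b h'c) !insf_hh0// scaler0 subr0.
have z' : proj_hh (bal (f - proj_hh f) (h - proj_hh h)) = 0.
  have k f' s : ((f' - proj_hh f') (onV s)).1 = 0.
    by rewrite -[LHS]/((f' _).1 - (proj_hh f' _).1) proj_fst onVK subrr.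
  have pf : parity b (f - proj_hh f).
    by rewrite addrC -scaleN1r; apply: parity_lin.
  have ph : parity c (h - proj_hh h).
    by rewrite addrC -scaleN1r; apply: parity_lin.
  rewrite (balE _ _ pf ph); [|exact: linN..].
  apply/funext => s; apply: pair_eqE => //; rewrite proj_fst.
  rewrite -[LHS]/((ins _ _ _).1 - _ *: (ins _ _ _).1) !ins_ker//.
  by rewrite scaler0 subr0.
have e : bal f h = 1 *: bal (f - proj_hh f) (h - proj_hh h) +
    (1 *: bal (proj_hh f) h + bal f (proj_hh h)).
  have {1}-> : f - proj_hh f = - 1 *: proj_hh f + f by rewrite scaleN1r addrC.
  have -> : h - proj_hh h = - 1 *: proj_hh h + h by rewrite scaleN1r addrC.
  rewrite bal_linl; last exact: multilinear_lin.
  by rewrite !bal_linr// z; lin F.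
by rewrite e !proj_lin z' scaler0 add0r scale1r.
Qed.

End Projection.

(** * Graded symmetry and the Jacobiator *)

Section SeqPredicates.
Variables (T : Type).

Fixpoint All (P : T -> Prop) (s : seq T) : Prop :=
  if s is x :: s' then P x /\ All P s' else True.

Lemma All_cat P s t : All P (s ++ t) <-> All P s /\ All P t.
Proof. by elim: s => /= [|x s IH]; tauto. Qed.

Lemma All_nth P x0 s : All P s <-> forall i, (i < size s)%N -> P (nth x0 s i).
Proof.
elim: s => [|x s IH] /=; first by split.
split=> [[Px /IH Ps] [|i]|H] //=; first exact: Ps.
by split; [apply: (H 0%N)|apply/IH => i; apply: (H i.+1)].
Qed.

Lemma All_perm_seq P x0 n (sigma : 'S_n) s :
  size s = n -> All P s -> All P (perm_seq x0 sigma s).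
Proof.
move=> sn /(All_nth P x0) Ps; apply/(All_nth P x0) => i;
  rewrite size_perm_seq => lti.
by rewrite (nth_perm_seq _ _ _ (Ordinal lti)); apply: Ps; rewrite sn.
Qed.

(** Used to move the arguments from L' to the front. The induction inserts the letters one by one
    into an already sorted prefix [s1 ++ s2]. *)
Lemma swap_sort_ind (P : seq T -> Prop) (a : pred T) :
  (forall u x y v, P (u ++ x :: y :: v) -> P (u ++ y :: x :: v)) ->
  (forall s1 s2, all a s1 -> all (predC a) s2 -> P (s1 ++ s2)) ->
  forall s, P s.
Proof.
move=> sw base s.
have bubble u x t v : P (u ++ x :: t ++ v) -> P (u ++ t ++ x :: v).
  elim: t u => // y t IH u H; rewrite /= -cat_rcons; apply: IH.
  by rewrite cat_rcons; apply: sw.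
suff H s1 s2 : all a s1 -> all (predC a) s2 -> P (s1 ++ s2 ++ s) by apply:
  (H [::] [::]).
elim: s s1 s2 => [|x s IH] s1 s2 a1 a2; first by rewrite cats0; apply: base.
case ax: (a x); last by rewrite -cat_rcons; apply: IH => //;
  rewrite all_rcons /= ax.
by apply: bubble; rewrite -cat_rcons; apply: IH => //; rewrite all_rcons ax.
Qed.

End SeqPredicates.

(** * Symmetry and additivity of sums over splittings *)

Section SplitSums.
Variables (F : fieldType) (W : lmodType F).

Lemma pass_cat (Z : Type) (deg : Z -> int) z A B :
  pass F deg z (A ++ B) = pass F deg z A * pass F deg z B.
Proof. by rewrite /pass big_cat. Qed.

Lemma pass_cons (Z : Type) (deg : Z -> int) z x A :
  pass F deg z (x :: A) = (-1) ^+ absz (deg x * deg z) * pass F deg z A.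
Proof. by rewrite /pass big_cons. Qed.

Lemma split_sum_map (Z Z' : Type) (deg : Z' -> int) (h : Z -> Z') zs
    (G : seq Z' -> seq Z' -> W) :
  split_sum deg (map h zs) G =
  split_sum (deg \o h) zs (fun A B => G (map h A) (map h B)).
Proof.
elim: zs G => [|z zs IH] G //=; rewrite !IH; congr (_ + _).
by apply: eq_split_sum => A B; rewrite /pass big_map.
Qed.

(** With [x] and [y] in the same block the symmetry of [G] applies; with [x] and [y] separated, the
    same splitting occurs on both sides and only [pass] changes, by the required sign. *)
Lemma split_sum_swap (Z : Type) (deg : Z -> int) (G :
  seq Z -> seq Z -> W) u x y v :
    (forall A1 A2 B, G (A1 ++ y :: x :: A2) B =
      (-1) ^+ absz (deg x * deg y) *: G (A1 ++ x :: y :: A2) B) ->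
    (forall A B1 B2, G A (B1 ++ y :: x :: B2) =
      (-1) ^+ absz (deg x * deg y) *: G A (B1 ++ x :: y :: B2)) ->
  split_sum deg (u ++ y :: x :: v) G =
  (-1) ^+ absz (deg x * deg y) *: split_sum deg (u ++ x :: y :: v) G.
Proof.
set c := (-1) ^+ _.
have cc : c * c = 1 by rewrite -expr2 /c sqrr_sign.
elim: u G => [|z u IH] G GA GB /=; last first.
  rewrite !IH; first by rewrite scalerDr.
  - by move=> A1 A2 B; rewrite GA /= !pass_cat !pass_cons !scalerA;
    congr (_ *: _); ring.
  - by move=> A B1 B2; rewrite (GB _ (z :: B1)) /= !scalerA mulrC.
  - by move=> A1 A2 B; apply: (GA (z :: A1)).
  - by move=> A B1 B2; apply: GB.
have cx A : pass F deg y (x :: A) = c * pass F deg y A by rewrite pass_cons.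
have cy A : pass F deg x (y :: A) = c * pass F deg x A by rewrite pass_cons
  [deg y * _]mulrC.
have -> : split_sum deg v (fun A B => G [:: y, x & A] B) =
    c *: split_sum deg v (fun A B => G [:: x, y & A] B).
  by rewrite split_sumZ; apply: eq_split_sum => A B; apply: (GA [::]).
have -> : split_sum deg v (fun A B => pass F deg x A *: (pass F deg y A *:
  G A [:: y, x & B])) =
    c *: split_sum deg v (fun A B => pass F deg y A *: (pass F deg x A *:
      G A [:: x, y & B])).
  rewrite split_sumZ; apply: eq_split_sum => A B.
  by rewrite (GB A [::]) !scalerA; congr (_ *: _); rewrite -/c; ring.
have -> : split_sum deg v (fun A B => pass F deg y (x :: A) *: G (x ::
  A) (y :: B)) =
    c *: split_sum deg v (fun A B => pass F deg y A *: G (x :: A) (y :: B)).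
  by rewrite split_sumZ; apply: eq_split_sum => A B; rewrite cx scalerA.
have -> : split_sum deg v (fun A B => pass F deg x (y :: A) *: G (y ::
  A) (x :: B)) =
    c *: split_sum deg v (fun A B => pass F deg x A *: G (y :: A) (x :: B)).
  by rewrite split_sumZ; apply: eq_split_sum => A B; rewrite cy scalerA.
by rewrite !scalerDr !scalerA cc !scale1r; lin F.
Qed.

Lemma split_sum_add (U : nmodType) (G : seq (int * U) -> seq (int * U) -> W) u
  d x y v :
    (forall A1 A2 B, G (A1 ++ (d, x + y) :: A2) B =
      G (A1 ++ (d, x) :: A2) B + G (A1 ++ (d, y) :: A2) B) ->
    (forall A B1 B2, G A (B1 ++ (d, x + y) :: B2) =
      G A (B1 ++ (d, x) :: B2) + G A (B1 ++ (d, y) :: B2)) ->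
  split_sum fst (u ++ (d, x + y) :: v) G =
  split_sum fst (u ++ (d, x) :: v) G + split_sum fst (u ++ (d, y) :: v) G.
Proof.
have SD zs G1 G2 : split_sum (fst : int * U -> int) zs (fun A B =>
  G1 A B + G2 A B) =
    split_sum fst zs G1 + split_sum fst zs G2 :> W.
  rewrite -[split_sum _ zs G1]scale1r -split_sum_lin;
    apply: eq_split_sum => A B.
  by rewrite scale1r.
elim: u G => [|z u IH] G GA GB /=; last first.
  rewrite !IH; first by lin F.
  - by move=> A1 A2 B; rewrite GA !pass_cat !pass_cons scalerDr.
  - by move=> A B1 B2; rewrite (GB _ (z :: B1)) scalerDr.
  - by move=> A1 A2 B; apply: (GA (z :: A1)).
  - by move=> A B1 B2; apply: GB.
transitivity (
  split_sum fst v (fun A B => G ((d, x) :: A) B + G ((d, y) :: A) B) +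
  split_sum fst v (fun A B => pass F fst (d, x) A *: G A ((d, x) :: B) +
                              pass F fst (d, y) A *: G A ((d, y) :: B))).
  congr (_ + _); apply: eq_split_sum => A B; first exact: (GA [::]).
  by rewrite (GB A [::]) scalerDr.
by rewrite !SD; lin F.
Qed.

End SplitSums.

Section Symmetry.
Variables (F : fieldType) (W : lmodType F) (hom : int -> W -> Prop) (l :
  seq W -> W).

Definition swap_symmetric :=
  forall u x y v, All (fun p => hom p.1 p.2) (u ++ x :: y :: v) ->
    l (map snd (u ++ y :: x :: v)) =
    (-1) ^+ absz (x.1 * y.1) *: l (map snd (u ++ x :: y :: v)).

Lemma homogeneous_zip ds xs : homogeneous_seq hom ds xs <->
  [/\ size ds = size xs & All (fun p => hom p.1 p.2) (zip ds xs)].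
Proof.
split=> [[sz H]|[sz /(All_nth _ (0, 0)) H]]; split=> //.
  apply/(All_nth _ (0, 0)) => i; rewrite size_zip sz minnn nth_zip//=; exact: H.
by move=> i lti; have := H i; rewrite size_zip sz minnn nth_zip//=; apply.
Qed.

Lemma koszul1 ds n : koszul F ds (1%g : 'S_n) = 1.
Proof.
rewrite /koszul big1// => a _; rewrite big1// => b; rewrite !perm1.
by case: ltngtP.
Qed.

Lemma perm_seq1 (T : Type) (x0 : T) n s : size s = n -> perm_seq x0 (1%g :
  'S_n) s = s.
Proof.
move=> sn; apply: (@eq_from_nth _ x0) => [|i]; first by rewrite size_perm_seq.
rewrite size_perm_seq => lti; rewrite (nth_perm_seq _ _ _ (Ordinal lti)).
by rewrite perm1.
Qed.

Lemma swap_perm (u v : seq (int * W)) x y : exists (sigma :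
  'S_(size (u ++ x :: y :: v))),
  perm_seq 0 sigma (map snd (u ++ x :: y :: v)) = map snd (u ++ y :: x :: v) /\
  koszul F (map fst (u ++ x :: y :: v)) sigma = (-1) ^+ absz (x.1 * y.1).
Proof.
elim: u => [|z u [s [s1 s2]]] /=.
  exists (lift_perm (lift ord0 ord0) ord0 (1%g : 'S_(size v).+1)).
  rewrite perm_seq_lift koszul_lift /= !perm_seq1 ?size_map//=;
    rewrite ?size_map//.
  by rewrite !take0 !drop0 koszul1 mulr1 big_cons big_nil mulr1 mulrC.
exists (lift_perm ord0 ord0 s).
by rewrite perm_seq_lift koszul_lift /= !take0 drop0 big_nil mul1r s2 s1.
Qed.

Lemma graded_symmetric_swap : graded_symmetric hom l -> swap_symmetric.
Proof.
move=> lS u x y v H; have [s [s1 s2]] := swap_perm u v x y.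
rewrite -s1 -s2; set zs := u ++ _ in H s s1 s2 *.
have sz : size (map snd zs) = size zs by rewrite size_map.
have hz : homogeneous_seq hom (map fst zs) (map snd zs).
  by apply/homogeneous_zip; rewrite !size_map -/(unzip1 zs) -/(unzip2 zs)
    zip_unzip.
have {lS} := lS _ _ hz; move: s {s1 s2}; rewrite -sz => s; exact.
Qed.

(** Built up by [lift_perm_ind], a permutation moves the first letter past [j] others by adjacent
    swaps, whose signs multiply to [pass]. *)
Lemma swap_symmetric_graded : swap_symmetric -> graded_symmetric hom l.
Proof.
move=> lS ds xs /homogeneous_zip[sz H].
have bubble u x t v : All (fun p => hom p.1 p.2) (u ++ x :: t ++ v) ->
    l (map snd (u ++ t ++ x :: v)) = pass F fst x t *: l (map snd (u ++ x ::
      t ++ v)).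
  elim: t u => [|y t IH] u Hu; first by rewrite /pass big_nil scale1r.
  rewrite /= -cat_rcons IH; last first.
    rewrite cat_rcons /=; move: Hu; rewrite !All_cat /=; tauto.
  by rewrite cat_rcons lS// scalerA pass_cons mulrC [x.1 * _]mulrC.
have key n (sigma : 'S_n) : forall zs u, size zs = n ->
    All (fun p => hom p.1 p.2) (u ++ zs) ->
    l (map snd (u ++ perm_seq 0 sigma zs)) =
    koszul F (map fst zs) sigma *: l (map snd (u ++ zs)).
  move: n sigma; apply: lift_perm_ind => [|n j sigma IH] [|z zs] u //=.
    by move=> _ _; rewrite koszul1 perm_seq1// scale1r.
  move=> [szs] Hu; rewrite perm_seq_lift koszul_lift bubble; last first.
    rewrite cat_take_drop; move: Hu; rewrite !All_cat /= => -[? [? ?]].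
    by split=> //; split=> //; apply: All_perm_seq.
  rewrite cat_take_drop -cat_rcons IH ?cat_rcons// scalerA; congr (_ * _ *: _).
  by rewrite /pass -(map_perm_seq fst (0 : int * W))// -[in RHS]map_take
    [RHS]big_map.
move=> sigma; have := key _ sigma (zip ds xs) [::] _ H.
rewrite size_zip sz minnn => /(_ erefl) /=.
rewrite (map_perm_seq snd 0 0) ?size_zip ?sz ?minnn//.
by rewrite -/(unzip2 _) -/(unzip1 _) unzip2_zip ?sz// unzip1_zip ?sz.
Qed.

(** The guard drops the splitting with empty inner bracket, as the Jacobi sum starts at 1. Labels in
    [Z] allow both pairs of a degree and an element, and generators. *)
Definition jacobiator (Z : Type) (deg : Z -> int) (w : Z -> W) (zs : seq Z) :
  W :=
  split_sum deg zs (fun A B =>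
    if nilp A then 0 else l (l (map w A) :: map w B)).

Lemma jacobiatorE ds xs : size ds = size xs -> (0 < size xs)%N ->
  \sum_(1 <= i < (size xs).+1) \sum_(sigma : 'S_(size xs) | shuffle i sigma)
      koszul F ds sigma *:
        l (l (take i (permute sigma xs)) :: drop i (permute sigma xs)) =
  jacobiator fst snd (zip ds xs).
Proof.
move=> sz xs0; rewrite /jacobiator.
have szip : size (zip ds xs) = size xs by rewrite size_zip sz minnn.
pose T i := \sum_(sigma : 'S_(size xs) | shuffle i sigma)
    koszul F (map fst (zip ds xs)) sigma *:
    (fun A B => if nilp A then 0 else l (l (map snd A) :: map snd B))
      (take i (perm_seq (0 : int * W) sigma (zip ds xs)))
      (drop i (perm_seq (0 : int * W) sigma (zip ds xs))).
rewrite -(split_sumE _ (0 : int * W) _ szip) -[RHS](big_mkord xpredT T) /T.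
rewrite [RHS]big_ltn// [X in X + _]big1 ?add0r; last first.
  by move=> sigma _; rewrite take0 scaler0.
apply: eq_big_nat => i /andP[i0 _]; apply: eq_bigr => sigma _.
rewrite -/(unzip1 _) unzip1_zip ?sz// /nilp size_take size_perm_seq.
have -> : ((if (i < size xs)%N then i else size xs) == 0%N) = false.
  by case: ifP => _; lia.
by rewrite map_take map_drop (map_perm_seq snd 0 0)// -/(unzip2 _) unzip2_zip
  ?sz.
Qed.

End Symmetry.

(** * Iterated brackets with elements of hh *)

Section SplitSumMore.
Variables (F : fieldType) (W : lmodType F) (Z : Type) (deg : Z -> int).

Definition total_parity (A : seq Z) : bool := odd (\sum_(a <- A) absz (deg a)).

Lemma total_parity_nil : total_parity [::] = false.
Proof. by rewrite /total_parity big_nil. Qed.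

Lemma total_parity_cons z A :
  total_parity (z :: A) = odd (absz (deg z)) (+) total_parity A.
Proof. by rewrite /total_parity big_cons oddD. Qed.

Lemma sign_abszM (x y : int) :
  (-1) ^+ absz (x * y) = sg F (odd (absz x) && odd (absz y)).
Proof. by rewrite /sg abszM -signr_odd oddM. Qed.

Lemma sg_addb b c : sg F (b (+) c) = sg F b * sg F c.
Proof. exact: signr_addb. Qed.

Lemma passE z A : pass F deg z A = sg F (odd (absz (deg z)) && total_parity A).
Proof.
elim: A => [|a A IH]; first by rewrite /pass big_nil total_parity_nil andbF.
by rewrite pass_cons total_parity_cons IH sign_abszM andbC andb_addr sg_addb.
Qed.

Lemma split_sum_nil zs (G : seq Z -> seq Z -> W) :
  (forall z A B, G (z :: A) B = 0) -> split_sum deg zs G = G [::] zs.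
Proof.
elim: zs G => //= z zs IH G G0.
have -> : split_sum deg zs (fun A B => G (z :: A) B) = 0.
  rewrite -[RHS](split_sum0 deg W zs).
  by apply: eq_split_sum => A B; rewrite G0.
rewrite add0r IH; first by rewrite /pass big_nil scale1r.
by move=> y A B; rewrite G0 scaler0.
Qed.

Lemma split_sum_eq0 zs (a : pred Z) (G : seq Z -> seq Z -> W) :
  (forall A B, (count a A + count a B)%N = count a zs ->
     (size A + size B)%N = size zs -> G A B = 0) ->
  split_sum deg zs G = 0.
Proof.
elim: zs G => [|z zs IH] G G0 /=; first exact: G0.
rewrite !IH ?addr0//.
- by move=> A B cAB sAB; rewrite G0 ?scaler0//= ?addnS ?sAB//; lia.
- by move=> A B cAB sAB; rewrite G0//= ?addSn ?sAB//; lia.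
Qed.

Lemma split_sum_sym zs (G : seq Z -> seq Z -> W) :
  split_sum deg zs G = split_sum deg zs (fun A B =>
    sg F (total_parity A && total_parity B) *: G B A).
Proof.
elim: zs G => [|z zs IH] G /=; first by rewrite total_parity_nil scale1r.
rewrite addrC; congr (_ + _); rewrite IH; apply: eq_split_sum => A B.
  rewrite passE scalerA total_parity_cons andb_addl sg_addb.
  by rewrite mulrC.
rewrite scalerA passE total_parity_cons andb_addr sg_addb mulrA -sg_addb.
by rewrite [total_parity A && odd _]andbC addbb mul1r.
Qed.

End SplitSumMore.

Section Folds.
Variables (F : fieldType) (char0 : [pchar F] =i pred0) (g V : lmodType F).
Local Notation E := (g * V)%type.
Implicit Types f h : seq E -> E.

(** What homogeneous elements of L' and of [hh] share with their iterated brackets, which may leave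
    both subspaces. *)
Record cochain (n : nat) f : Prop := Good {
  cochain0 : f [::] = 0; cochainM : multilinear f; cochainB : bounded_arity f;
  cochainD : has_degree n f }.

Lemma cochainP n f : cochain n f -> parity (odd n) f.
Proof. by case=> _ _ _; apply: has_degree_parity. Qed.

Lemma cochain_bal m n f h : cochain m f -> cochain n h ->
  cochain (m + n) (bal f h).
Proof.
move=> [f0 fm fb fd] [h0 hm hb hd]; split.
- by rewrite /bal !fctE /insf /= !subr0.
- exact: multilinear_bal.
- exact: bounded_arity_bal.
- by rewrite PoszD; apply: has_degree_bal.
Qed.

Lemma cochain_lin n f h a : cochain n f -> cochain n h -> cochain n (a *:
  f + h).
Proof.
move=> [f0 fm fb fd] [h0 hm hb hd]; split.
- by rewrite !fctE f0 h0 scaler0 addr0.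
- exact: multilinear_lin.
- exact: bounded_arity_lin.
- exact: has_degree_lin.
Qed.

Lemma cochain_eq m n f : m = n -> cochain m f -> cochain n f.
Proof. by move=> ->. Qed.

Lemma cochain_zero n : cochain n 0.
Proof. by split=> //; [move=> s t a x y; rewrite scaler0 addr0|exists 0%N]. Qed.

Lemma cochain_proj n f : cochain n f -> cochain n (proj_hh f).
Proof.
move=> [f0 fm fb fd]; have := hh_prop_proj f0 fm fb => /hh_propP[? ? ? _].
by split=> //; apply: has_degree_proj.
Qed.

(** The degree is stored because zero has every degree. *)
Record homL := HomL {
  homL_deg : nat; homL_val : Lprime g V; homLP : has_degree homL_deg homL_val }.
Record homh := Homh {
  homh_deg : nat; homh_val : hh g V; homhP : has_degree homh_deg homh_val }.

Lemma Lprime_valP (Q : Lprime g V) : Lprime_prop Q.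
Proof. by case: Q => Q /= /asboolP. Qed.

Lemma hh_valP (t : hh g V) : hh_prop t.
Proof. by case: t => t /= /asboolP. Qed.

Lemma cochain_homL (Q : homL) : cochain (homL_deg Q) (homL_val Q).
Proof.
have [Q0 QM QB _ _] := (Lprime_propP char0 _).1 (Lprime_valP (homL_val Q)).
by split=> //; apply: homLP.
Qed.

Definition fold_bal f (ts : seq homh) : seq E -> E :=
  foldl (@bal F E) f (map (fun t => hh_val (homh_val t)) ts).

Definition tdeg (ts : seq homh) : nat := \sum_(t <- ts) homh_deg t.

Definition hdeg (t : homh) : int := homh_deg t.

Lemma cochain_homh (t : homh) : cochain (homh_deg t) (homh_val t).
Proof.
by have [? ? ? _] := hh_propP (hh_valP (homh_val t)); split=> //; apply: homhP.
Qed.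

Lemma total_tdeg ts : total_parity hdeg ts = odd (tdeg ts).
Proof. by []. Qed.

Lemma cochain_fold n f ts : cochain n f ->
  cochain (n + tdeg ts) (fold_bal f ts).
Proof.
rewrite /tdeg; elim: ts n f => [|t ts IH] n f fg /=.
  by rewrite big_nil addn0.
rewrite big_cons addnA; apply: IH; apply: cochain_bal => //;
  exact: cochain_homh.
Qed.

Lemma fold_balD n f h ts : cochain n f -> cochain n h ->
  fold_bal (f + h) ts = fold_bal f ts + fold_bal h ts.
Proof.
elim: ts n f h => //= t ts IH n f h fg hg.
rewrite {1}/fold_bal /= balDl; last exact: cochainM (cochain_homh t).
by apply: (IH (n + homh_deg t)%N); apply: cochain_bal => //;
  apply: cochain_homh.
Qed.

Lemma fold_balZ a f ts : fold_bal (a *: f) ts = a *: fold_bal f ts.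
Proof.
elim: ts f => //= t ts IH f.
rewrite {1}/fold_bal /= balZl; last exact: (cochainM (cochain_homh t)).
exact: IH.
Qed.

(** The iterated derivation rule: every element of [ts] acts on [a] or on [b], and those acting on
    [a] first pass [b]. *)
Lemma fold_bal_split m n a b ts : cochain m a -> cochain n b ->
  fold_bal (bal a b) ts = split_sum hdeg ts (fun A B =>
    sg F (odd n && total_parity hdeg A) *: bal (fold_bal a A) (fold_bal b B)).
Proof.
elim: ts m n a b => [|t ts IH] m n a b ag bg /=.
  by rewrite total_parity_nil andbF scale1r.
have tg := cochain_homh t; set t' : seq E -> E := homh_val t in tg *.
rewrite {1}/fold_bal /= -/(fold_bal _ _).
rewrite (bal_leibniz (cochainM ag) (cochainM bg) (cochainM tg) (cochainP ag)
  (cochainP bg) (cochainP tg)).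
have hd : cochain (m + n + homh_deg t) (bal (bal a t') b).
  by apply: cochain_eq (cochain_bal (cochain_bal ag tg) bg); lia.
rewrite (fold_balD _ (n := (m + n + homh_deg t)%N)); first last.
- by rewrite -[_ *: _]addr0; apply: cochain_lin => //; apply: cochain_zero.
- by apply: cochain_eq (cochain_bal ag (cochain_bal bg tg)); lia.
rewrite addrC fold_balZ; congr (_ + _).
  rewrite (IH _ _ _ _ (cochain_bal ag tg) bg) split_sumZ.
  apply: eq_split_sum => A B; rewrite scalerA total_parity_cons andb_addr
    sg_addb.
  by [].
rewrite (IH _ _ _ _ ag (cochain_bal bg tg)); apply: eq_split_sum => A B.
by rewrite passE scalerA oddD andb_addl sg_addb mulrC.
Qed.

Lemma bal_hh0 f h m n : cochain m f -> cochain n h -> hh_prop f -> hh_prop h ->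
  bal f h = 0.
Proof.
move=> fg hg fH hH; rewrite (balE (cochainM fg) (cochainM hg) (cochainP fg)
  (cochainP hg)).
by rewrite !insf_hh0// scaler0 subr0.
Qed.

(** Since [hh] is abelian, the derivation rule moves [e] outwards past each element of [ts] at the
    cost of a sign only. *)
Lemma fold_bal_comm n k b e ts : cochain n b -> cochain k e -> hh_prop e ->
  fold_bal (bal b e) ts =
  sg F (odd k && total_parity hdeg ts) *: bal (fold_bal b ts) e.
Proof.
move=> bg eg eH; elim: ts n b bg => [|t ts IH] n b bg.
  by rewrite total_parity_nil andbF scale1r.
have tg := cochain_homh t; have tH := hh_valP (homh_val t).
rewrite {1}/fold_bal /= -/(fold_bal _ _).
rewrite (bal_leibniz (cochainM bg) (cochainM eg) (cochainM tg) (cochainP bg)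
  (cochainP eg) (cochainP tg)).
rewrite (bal_hh0 eg tg eH tH) (bal0r (cochainM bg)) add0r fold_balZ.
rewrite (IH _ _ (cochain_bal bg tg)) scalerA total_parity_cons andb_addr
  sg_addb.
by [].
Qed.

Lemma proj_is_linear : linear (@proj_hh F g V).
Proof. by move=> a f h; apply: proj_lin. Qed.

HB.instance Definition _ := GRing.isLinear.Build F (seq E -> E) (seq E -> E)
  *:%R (@proj_hh F g V) proj_is_linear.

Lemma hh_prop_proj_good n f : cochain n f -> hh_prop (proj_hh f).
Proof. by case=> *; apply: hh_prop_proj. Qed.

(** Apply [proj_bal] to each summand of [fold_bal_split], then move the projected factor back inside
    by [fold_bal_comm]. In the second sum the roles of [A] and [B] are exchanged, hence
    [split_sum_sym]. *)
Lemma proj_fold_bal m n a b ts : cochain m a -> cochain n b ->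
  proj_hh (fold_bal (bal a b) ts) =
  split_sum hdeg ts (fun A B => - sg F (odd m && odd n) *:
    proj_hh (fold_bal (bal b (proj_hh (fold_bal a A))) B)) +
  split_sum hdeg ts (fun A B =>
    proj_hh (fold_bal (bal a (proj_hh (fold_bal b A))) B)).
Proof.
move=> ag bg; rewrite (fold_bal_split _ ag bg) split_sum_linear.
rewrite [X in _ = _ + X]split_sum_sym -[X in _ = X + _]scale1r -split_sum_lin.
apply: eq_split_sum => A B; rewrite linearZ /=.
have aA := cochain_fold A ag; have bB := cochain_fold B bg.
rewrite (proj_bal (cochainM aA) (cochainM bB) (cochain0 aA) (cochain0 bB)
  (cochainB aA) (cochainB bB)
  (cochainP aA) (cochainP bB)).
have eA := cochain_proj aA; have eB := cochain_proj bB.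
have hA := hh_prop_proj_good aA; have hB := hh_prop_proj_good bB.
rewrite (fold_bal_comm _ bg eA hA) (fold_bal_comm _ ag eB hB).
rewrite (bal_anti (cochainM eA) (cochainM bB) (cochainP eA) (cochainP bB)).
rewrite !linearZ /= !oddD !total_tdeg.
rewrite /sg; case: (odd m) (odd n) (odd (tdeg A)) (odd (tdeg B)) =>
  [] [] [] [] /=;
  lin F.
Qed.

End Folds.

(** * The Jacobi identities *)

Section Derived.
Variables (F : fieldType) (char0 : [pchar F] =i pred0) (g V : lmodType F).
Local Notation E := (g * V)%type.
Local Notation W := (sLh g V).
Local Notation homL := (homL g V).
Local Notation homh := (homh g V).
Local Notation hdeg := (@hdeg F g V).

Definition gen := (homL + homh)%type.

Definition gen_deg (z : gen) : int :=
  match z with inl Q => (homL_deg Q)%:Z - 1 | inr t => hdeg t end.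

Definition gen_raw (z : gen) : Lprime g V + hh g V :=
  match z with inl Q => inl (homL_val Q) | inr t => inr (homh_val t) end.

Definition gen_val (z : gen) : W := insLh (gen_raw z).

Definition gen_pair (z : gen) : int * W := (gen_deg z, gen_val z).

Lemma gen_hom z : sLh_hom (gen_deg z) (gen_val z).
Proof.
case: z => [Q|t]; split=> //=; last exact: homhP.
by rewrite subrK; apply: homLP.
Qed.

Lemma sLh_hom_lin i a (x y : W) : sLh_hom i x -> sLh_hom i y ->
  sLh_hom i (a *: x + y).
Proof.
move=> [x1 x2] [y1 y2]; split.
  exact: (has_degree_lin a x1 y1).
exact: (has_degree_lin a x2 y2).
Qed.

Lemma sLh_homZ i a (x : W) : sLh_hom i x -> sLh_hom i (a *: x).
Proof. by move=> xi; rewrite -[a *: x]addr0; apply: sLh_hom_lin. Qed.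

(* A homogeneous element is a sum of at most two generators. *)
Lemma gen_ind (P : seq (int * W) -> Prop) :
    (forall u d v, P (u ++ (d, 0) :: v)) ->
    (forall u d x y v, P (u ++ (d, x) :: v) -> P (u ++ (d, y) :: v) ->
       P (u ++ (d, x + y) :: v)) ->
    (forall zs, P (map gen_pair zs)) ->
  forall zs, All (fun p => sLh_hom p.1 p.2) zs -> P zs.
Proof.
move=> P0 PD Pg zs.
suff H (us : seq gen) : All (fun p => sLh_hom p.1 p.2) zs -> P (map gen_pair us
  ++ zs).
  exact: (H [::]).
elim: zs us => [|[d [Q t]] zs IH] us /=; first by rewrite cats0.
case=> [[/= Qd td]] zsh.
have -> : (Q, t) = desusp Q + inhh t by rewrite /desusp /inhh -[RHS]/(Q + 0,
  0 + t) addr0 add0r.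
have step z : gen_deg z = d -> P (map gen_pair us ++ (d, gen_val z) :: zs).
  by move=> <-; rewrite -cat_rcons -map_rcons; apply: IH.
have nat0 (U : lmodType F) (f : seq U -> U) (p : int) :
  has_degree p f -> f [::] = 0 -> p < 0 -> f = 0.
  move=> fp f0 p0; apply/funext => -[//|x s]; apply: fp => /=; lia.
apply: PD.
  (* The L'-part has degree [d + 1] in L', so [d = -1] still gives a generator; for smaller [d] it
     is zero. *)
  case: d Qd {td} step => [n|[|n]] Qd step.
  - have Qn : has_degree n.+1 Q by move: Qd; rewrite -PoszD addn1.
    by apply: (step (inl (HomL Qn))) => /=; lia.
  - have Qn : has_degree 0%N Q by [].
    by apply: (step (inl (HomL Qn))).
  - have -> : Q = 0; last exact: P0.
    apply: val_inj; apply: nat0 Qd _ _ => //.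
    by have [] := (Lprime_propP char0 _).1 (Lprime_valP Q).
case: d td {Qd} step => [n|n] td step; first exact: (step (inr (Homh td))).
have -> : t = 0; last exact: P0.
apply: val_inj; apply: nat0 td _ _ => //.
by have [] := hh_propP (hh_valP t).
Qed.

Variables (l : seq W -> W) (lD : derived_brackets l).

Lemma l_add u x y v : l (u ++ (x + y) :: v) = l (u ++ x :: v) + l (u ++ y :: v).
Proof. by have := derived_multilinear lD u v 1 x y; rewrite !scale1r. Qed.

Lemma l_gen_swap u x y v :
  l (map gen_val (u ++ y :: x :: v)) =
  (-1) ^+ absz (gen_deg x * gen_deg y) *: l (map gen_val (u ++ x :: y :: v)).
Proof.
have := graded_symmetric_swap (derived_symmetric lD) (u := map gen_pair u)
  (x := gen_pair x) (y := gen_pair y) (v := map gen_pair v).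
have mE s : map gen_val s = map snd (map gen_pair s) by rewrite -map_comp.
rewrite !mE !map_cat /=; apply.
suff H zs : All (fun p => sLh_hom p.1 p.2) (map gen_pair zs).
  by have := H (u ++ x :: y :: v); rewrite map_cat.
by elim: zs => //= z zs IH; split=> //; apply: gen_hom.
Qed.

Definition isL (z : gen) := is_inl z.

Lemma count_raw zs : count is_inl (map gen_raw zs) = count isL zs.
Proof. by rewrite count_map; apply: eq_count => -[]. Qed.

Lemma l_vanish (zs : seq (Lprime g V + hh g V)) : let m := count is_inl zs in
  ~~ ((m == 1) && (2 <= size zs))%N -> ~~ ((m == 2) && (size zs == 2))%N ->
  l (map (@insLh F g V) zs) = 0.
Proof. exact: derived_vanish. Qed.

Lemma l_gen_vanish zs : let m := count isL zs in
  ~~ ((m == 1) && (2 <= size zs))%N -> ~~ ((m == 2) && (size zs == 2))%N ->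
  l (map gen_val zs) = 0.
Proof.
by have := @l_vanish (map gen_raw zs); rewrite count_raw size_map -map_comp.
Qed.

Lemma l_LL (Q Q' : homL) : exists2 R : homL,
  homL_deg R = (homL_deg Q + homL_deg Q')%N /\
  homL_val R = sg F (odd (homL_deg Q)) *: bal (homL_val Q) (homL_val Q') :>
    (seq E -> E)
  & l [:: gen_val (inl Q); gen_val (inl Q')] = gen_val (inl R).
Proof.
have [R RE lE] := derived_LL lD (@homLP F g V Q) (@homLP F g V Q').
have Qg := cochain_homL char0 Q; have Qg' := cochain_homL char0 Q'.
rewrite (balavoineE (cochainM Qg) (cochainM Qg') (cochainP Qg) (cochainP Qg'))
  in RE.
have Rd : has_degree (homL_deg Q + homL_deg Q')%N R.
  rewrite RE -[_ *: _]addr0; apply: has_degree_lin => //.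
  by case: (cochain_bal Qg Qg').
by exists (HomL Rd) => //=; split=> //; rewrite RE /sg signr_odd.
Qed.

Lemma foldl_balavoine n f (ts : seq homh) : cochain n f ->
  foldl (@balavoine F E) f (map (@hh_val F g V) (map (@homh_val F g V) ts)) =
  fold_bal f ts.
Proof.
elim: ts n f => //= t ts IH n f fg; have tg := cochain_homh t.
rewrite (balavoineE (cochainM fg) (cochainM tg) (cochainP fg) (cochainP tg)).
exact: IH (cochain_bal fg tg).
Qed.

Lemma map_gen_inr (ts : seq homh) :
  map gen_val (map inr ts) = map (@inhh F g V) (map (@homh_val F g V) ts).
Proof. by elim: ts => //= t ts ->. Qed.

Lemma l_Lh (Q : homL) (ts : seq homh) : exists2 t : homh,
  homh_deg t = (homL_deg Q + tdeg ts)%N /\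
  homh_val t = proj_hh (fold_bal (homL_val Q) ts) :> (seq E -> E)
  & l (map gen_val (inl Q :: map inr ts)) = gen_val (inr t).
Proof.
have Qg := cochain_homL char0 Q; have fg := cochain_proj (cochain_fold ts Qg).
(* Without elements of [hh] the formula would read l_1 = P Q, and both sides are zero: Q has no
   component taking arguments from [V] alone to [g]. *)
case: ts fg => [|t ts] fg.
  have z : has_degree (homL_deg Q + tdeg ([::] : seq homh))%N (0 :
    hh g V) by [].
  exists (Homh z) => /=; last first.
    by rewrite (l_gen_vanish (zs := [:: inl Q])).
  split=> //; apply/funext => s; apply: pair_eqE => //.
  rewrite proj_fst /fold_bal /=; have [Q0 QM _ QR _] := (Lprime_propP char0
    _).1 (Lprime_valP (homL_val Q)).
  case: s => [|x s]; first by rewrite Q0.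
  by rewrite (QR.1 _ (0 :: @onV F g V (map snd s))) ?multilinear_cons0.
have hd (us : seq homh) u : u \in map (@homh_val F g V) us -> exists d : nat,
  has_degree d u.
  elim: us => //= x us IH; rewrite inE => /orP[/eqP->|]; last exact: IH.
  by exists (homh_deg x); exact: homhP.
have [||eta etaE lE] := derived_Lh lD (ts := map (@homh_val F g V) (t ::
  ts)) (@homLP F g V Q) _ _.
- by rewrite size_map.
- exact: hd.
rewrite (foldl_balavoine _ Qg) in etaE.
have d : has_degree (homL_deg Q + tdeg (t :: ts))%N eta by rewrite etaE;
  apply: cochainD.
exists (Homh d) => //; apply: etrans lE; congr (l (_ :: _)).
exact: (map_gen_inr (t :: ts)).
Qed.

Lemma gen_sort_ind (P : seq gen -> Prop) :
    (forall u x y v, P (u ++ x :: y :: v) -> P (u ++ y :: x :: v)) ->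
    (forall (Qs : seq homL) (ts : seq homh), P (map inl Qs ++ map inr ts)) ->
  forall zs, P zs.
Proof.
move=> sw base; apply: (swap_sort_ind (a := isL)) => // s1 s2 a1 a2.
have [Qs ->] : exists Qs, s1 = map inl Qs.
  elim: s1 a1 => [|[Q|t] s IH] //=; first by exists [::].
  by move=> /IH[Qs ->]; exists (Q :: Qs).
have [ts ->] : exists ts, s2 = map inr ts.
  elim: s2 a2 => [|[Q|t] s IH] //=; first by exists [::].
  by move=> /IH[ts ->]; exists (t :: ts).
exact: base.
Qed.

Lemma count_inlr (Qs : seq homL) (ts : seq homh) :
  count isL (map inl Qs ++ map inr ts) = size Qs.
Proof.
rewrite count_cat; elim: Qs => [|Q Qs IH]; first by elim: ts.
by rewrite -[size _]/(size Qs).+1 -IH.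
Qed.

(** Allows counting the L'-arguments of an outer bracket: an inner bracket counts as one exactly
    when it contains two. A zero value is read in whichever summand fits. *)
Lemma l_gen_type zs : exists2 z, l (map gen_val zs) = insLh z &
  is_inl z = (count isL zs == 2)%N.
Proof.
elim/gen_sort_ind: zs => [u x y v [z lz cz]|Qs ts].
  set c : F := (-1) ^+ absz (gen_deg x * gen_deg y).
  exists (match z with inl Q => inl (c *: Q) | inr t => inr (c *: t) end).
    rewrite l_gen_swap lz -/c; case: z {lz cz} => [Q|t].
      by rewrite /= /desusp -[LHS]/(c *: Q, c *: 0) scaler0.
    by rewrite /= /inhh -[LHS]/(c *: 0, c *: t) scaler0.
  have <- : count isL (u ++ [:: x, y & v]) = count isL (u ++ [:: y, x & v]).
    by rewrite !count_cat /=; lia.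
  by rewrite -cz; case: z {lz cz}.
have c := count_inlr Qs ts.
case: Qs c => [|Q [|Q' [|Q'' Qs]]] c.
- by exists (inr 0); rewrite ?c//; apply: l_gen_vanish; rewrite c.
- have [t _ lt] := l_Lh Q ts; exists (inr (homh_val t)); rewrite ?c//.
- case: ts c => [|t ts] c; last first.
    by exists (inl 0); rewrite ?c//; apply: l_gen_vanish; rewrite c.
  have [R _ lR] := l_LL Q Q'; by exists (inl (homL_val R)).
- by exists (inr 0); rewrite ?c//; apply: l_gen_vanish; rewrite c.
Qed.

Lemma l_degree ds xs : homogeneous_seq (@sLh_hom F g V) ds xs ->
  sLh_hom (\sum_(d <- ds) d + 1) (l xs).
Proof.
move=> /homogeneous_zip[sz H].
have {H} := gen_ind (P := fun zs => sLh_hom (\sum_(p <- zs) p.1 + 1) (l (map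
  snd zs))) _ _ _ H.
rewrite -(big_map fst xpredT id) -/(unzip1 _) -/(unzip2 _) unzip1_zip ?sz//
  unzip2_zip ?sz//.
apply.
- by move=> u d v; rewrite map_cat /= (multilinear0 _ _ (derived_multilinear
  lD)); split.
- move=> u d x y v; rewrite !map_cat /= l_add !big_cat !big_cons /= => hx hy.
  by rewrite -[l (_ ++ x :: _)]scale1r; apply: sLh_hom_lin.
move=> zs; rewrite -[map snd _]map_comp big_map.
elim/gen_sort_ind: zs => [u x y v|Qs ts].
  rewrite (l_gen_swap u x y v) => H; apply: sLh_homZ; move: H.
  by rewrite !big_cat !big_cons /= [gen_deg x + (_ + _)]addrCA.
have c := count_inlr Qs ts.
case: Qs c => [|Q [|Q' [|Q'' Qs]]] c.
- by rewrite l_gen_vanish; rewrite ?c//; split.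
- have [t [td _] lt] := l_Lh Q ts; rewrite lt.
  have -> : \sum_(z <- map inl [:: Q] ++ map inr ts) gen_deg z + 1 = gen_deg
    (inr t).
    rewrite big_cons big_map /= /hdeg td PoszD /tdeg.
    rewrite (big_morph Posz PoszD (erefl 0)); ring.
  exact: gen_hom.
- case: ts c => [|t ts] c; last by rewrite l_gen_vanish; rewrite ?c//; split.
  have [R [Rd _] lR] := l_LL Q Q'; rewrite lR.
  have -> : \sum_(z <- map inl [:: Q; Q'] ++ map inr [::]) gen_deg z + 1 =
    gen_deg (inl R).
    by rewrite !big_cons big_nil /= Rd PoszD; ring.
  exact: gen_hom.
- by rewrite l_gen_vanish; rewrite ?c//; split.
Qed.

Definition jac_term (A B : seq gen) : W :=
  if nilp A then 0 else l (l (map gen_val A) :: map gen_val B).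

Lemma l_cons0 xs : l (0 :: xs) = 0.
Proof. exact: multilinear_cons0 (derived_multilinear lD). Qed.

(** A nonzero inner bracket has one L'-argument and a value in [hh], or exactly two arguments, both
    from L', and a value in L'. The same dichotomy for the outer bracket leaves only these
    totals. *)
Lemma jac_term_vanish A B : let m := (count isL A + count isL B)%N in
  m != 2%N -> ~~ ((m == 3) && (size A + size B == 3))%N -> jac_term A B = 0.
Proof.
move=> m m2 m3; rewrite /jac_term; case: ifP => // _.
case cA: (((count isL A == 1) && (2 <= size A)) || ((count isL A == 2) && (size
  A == 2)))%N; last first.
  by rewrite l_gen_vanish ?l_cons0//; move/negbT: cA;
    rewrite negb_or => /andP[].
have [z -> cz] := l_gen_type A.
have -> : map gen_val B = map (@insLh F g V) (map gen_raw B) by rewrite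
  -map_comp.
apply: (l_vanish (zs := z :: map gen_raw B)); rewrite /= size_map count_raw cz;
  move: m2 m3 cA (count_size isL B); rewrite {}/m;
    move: (count isL A) (count isL B) (size A) (size B);
  move=> a b sa sb; case e: (a == 2)%N; rewrite ?add1n ?add0n; move/eqP: e; lia.
Qed.

Lemma jac_swap u x y v :
  jacobiator l gen_deg gen_val (u ++ y :: x :: v) =
  (-1) ^+ absz (gen_deg x * gen_deg y) *:
    jacobiator l gen_deg gen_val (u ++ x :: y :: v).
Proof.
have lZ c w xs : l (c *: w :: xs) = c *: l (w :: xs).
  exact: (multilinearZ [::] xs c w (derived_multilinear lD)).
apply: split_sum_swap => [A1 A2 B|A B1 B2].
  by rewrite /nilp !size_cat /= !addnS /= l_gen_swap lZ.
case: ifP => _; first by rewrite scaler0.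
have hA : All (fun p => sLh_hom p.1 p.2) (map gen_pair A).
  by elim: A => //= z A IH; split=> //; apply: gen_hom.
(* Symmetry of the outer bracket in [B] requires a homogeneous inner value. *)
have dA : sLh_hom (\sum_(d <- map gen_deg A) d + 1) (l (map gen_val A)).
  apply: l_degree; apply/homogeneous_zip; rewrite !size_map; split=> //.
  by rewrite zip_map.
have hB : All (fun p => sLh_hom p.1 p.2) (map gen_pair (B1 ++ [:: x, y & B2])).
  by elim: (B1 ++ _) => //= z s IH; split=> //; apply: gen_hom.
rewrite map_cat /= in hB.
have := graded_symmetric_swap (derived_symmetric lD)
  (u := (\sum_(d <- map gen_deg A) d + 1, l (map gen_val A)) :: map gen_pair B1)
  (x := gen_pair x) (y := gen_pair y) (v := map gen_pair B2) (conj dA hB).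
by rewrite /= !map_cat /= -![map snd _]map_comp.
Qed.

Lemma odd_pred_int n : odd (absz (n%:Z - 1)) = ~~ odd n.
Proof. by case: n => [|n] //; rewrite -addn1 PoszD addrK oddD addbT negbK. Qed.

Lemma l_gen1 z : l [:: gen_val z] = 0.
Proof. by apply: (l_gen_vanish (zs := [:: z])); case: z. Qed.

Lemma gen_inlE (Q : homL) : gen_val (inl Q) = desusp (homL_val Q).
Proof. by []. Qed.

(** Here l_1 and l_3 vanish, leaving the three (2,1)-shuffles. With the signs of the desuspension
    these form the graded Jacobi identity [bal_leibniz]. *)
Lemma jac_LLL (Q1 Q2 Q3 : homL) :
  jacobiator l gen_deg gen_val [:: inl Q1; inl Q2; inl Q3] = 0.
Proof.
have [R12 [d12 e12] l12] := l_LL Q1 Q2.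
have [R13 [d13 e13] l13] := l_LL Q1 Q3.
have [R23 [d23 e23] l23] := l_LL Q2 Q3.
have [S12 [_ f12] k12] := l_LL R12 Q3.
have [S13 [_ f13] k13] := l_LL R13 Q2.
have [S23 [_ f23] k23] := l_LL R23 Q1.
have v3 : l [:: gen_val (inl Q1); gen_val (inl Q2); gen_val (inl Q3)] = 0.
  exact: (l_gen_vanish (zs := [:: inl Q1; inl Q2; inl Q3])).
rewrite /jacobiator /= v3 !l_gen1 !l_cons0 l12 l13 l23 k12 k13 k23.
rewrite !passE !total_parity_cons !total_parity_nil /= !odd_pred_int.
rewrite !scaler0 !addr0 !add0r !gen_inlE.
rewrite andbF [sg F false]/sg scale1r; set c13 := sg F _; set c23 := sg F _.
have -> : desusp (homL_val S12) + c13 *: desusp (homL_val S13) + c23 *: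
  desusp (homL_val S23) = desusp (homL_val S12 + c13 *: homL_val S13 + c23 *:
    homL_val S23).
  rewrite /desusp -[LHS]/(homL_val S12 + c13 *: homL_val S13 + c23 *:
    homL_val S23, 0 + c13 *: 0 + c23 *: 0).
  by rewrite !scaler0 !addr0.
suff -> : homL_val S12 + c13 *: homL_val S13 + c23 *: homL_val S23 = 0 by [].
apply: val_inj; apply/funext => s.
rewrite -[LHS]/(Lprime_val (homL_val S12) s + c13 *:
  Lprime_val (homL_val S13) s + c23 *: Lprime_val (homL_val S23) s).
have g1 := cochain_homL char0 Q1; have g2 := cochain_homL char0 Q2;
  have g3 := cochain_homL char0 Q3.
have g23 := cochain_bal g2 g3.
rewrite f12 f13 f23 e12 e13 e23 d12 d13 d23 !balZl; try exact: cochainM;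
  do ?exact: (cochainM g1); do ?exact: (cochainM g2); do ?exact: (cochainM g3).
rewrite (bal_leibniz (cochainM g1) (cochainM g2) (cochainM g3) (cochainP g1)
  (cochainP g2) (cochainP g3)).
rewrite (bal_anti (cochainM g23) (cochainM g1) (cochainP g23) (cochainP g1)).
rewrite -[RHS]/(0 : E) !fctE /c13 /c23 /sg !oddD.
case: (odd (homL_deg Q1)) (odd (homL_deg Q2)) (odd (homL_deg Q3)) =>
  [] [] [] /=; lin F.
Qed.

Definition comp1 (w : W) : Lprime g V := w.1.
Definition comp2 (w : W) : seq E -> E := w.2.

Lemma comp1_is_linear : linear comp1. Proof. by []. Qed.
Lemma comp2_is_linear : linear comp2. Proof. by []. Qed.

HB.instance Definition _ := GRing.isLinear.Build F W (Lprime g V) *:%R comp1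
  comp1_is_linear.
HB.instance Definition _ := GRing.isLinear.Build F W (seq E -> E) *:%R comp2
  comp2_is_linear.

Lemma comp_eq0 w : comp1 w = 0 -> comp2 w = 0 -> w = 0.
Proof. by case: w => Q t /= -> /= t0; congr (_, _); apply: val_inj. Qed.

(** The sign comes from moving the inner value, of degree [homL_deg Q + tdeg A], past the
    desuspension of [Q'], of degree [homL_deg Q' - 1]. *)
Lemma jac_term_LL (Q Q' : homL) (A B : seq homh) : exists2 t : homh,
  jac_term (inl Q :: map inr A) (inl Q' :: map inr B) =
    sg F (odd (homL_deg Q + tdeg A) && ~~ odd (homL_deg Q')) *:
      gen_val (inr t) &
  homh_val t = proj_hh (fold_bal (bal (homL_val Q') (proj_hh (fold_bal
    (homL_val Q) A))) B) :> (seq E -> E).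
Proof.
have [t [dt et] lt] := l_Lh Q A; have [t' [_ et'] lt'] := l_Lh Q' (t :: B).
exists t'; last by rewrite et' -et.
rewrite /jac_term [nilp _]/= lt -lt' andbC.
have := l_gen_swap [::] (inl Q') (inr t) (map inr B).
rewrite !cat0s sign_abszM /= odd_pred_int /hdeg dt /= => <-.
by [].
Qed.

(** If the inner bracket contains both [Q] and [Q'] it admits nothing else; if it contains neither
    it vanishes; if it contains one, [jac_term_LL] evaluates the term. The three surviving
    contributions cancel by [proj_fold_bal]. *)
Lemma jac_LL (Q Q' : homL) (ts : seq homh) :
  jacobiator l gen_deg gen_val (inl Q :: inl Q' :: map inr ts) = 0.
Proof.
rewrite -[jacobiator _ _ _ _]/(split_sum gen_deg _ jac_term).
have SM (G : seq gen -> seq gen -> W) : split_sum gen_deg (map inr ts) G =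
    split_sum hdeg ts (fun A B => G (map inr A) (map inr B)).
  exact: split_sum_map.
rewrite [split_sum _ _ _]/= !SM.
have [R [dR eR] lR] := l_LL Q Q'; have [tR [_ etR] lR'] := l_Lh R ts.
have v0 A B : jac_term (map inr A) B = 0.
  rewrite /jac_term; case: ifP => // _; rewrite l_gen_vanish ?l_cons0//;
  by have := count_inlr [::] A => /= ->.
have v2 t A B : jac_term [:: inl Q, inl Q', inr t & map inr A] B = 0.
  rewrite /jac_term [nilp _]/= l_gen_vanish ?l_cons0//;
  by have := count_inlr [:: Q; Q'] (t :: A) => /= ->.
rewrite [X in X + _ + _]split_sum_nil; last by move=> t A B; apply: v2.
have -> : jac_term [:: inl Q; inl Q'] (map inr ts) = gen_val (inr tR).
  by rewrite /jac_term [nilp _]/= -lR' /= lR.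
rewrite [X in _ + X](_ : _ = split_sum hdeg ts (fun A B =>
  pass F gen_deg (inl Q) (inl Q' :: map inr A) *:
         jac_term (inl Q' :: map inr A) (inl Q :: map inr B))); last first.
  rewrite -[RHS]addr0; congr (_ + _); rewrite -[RHS](split_sum0 hdeg W ts).
  by apply: eq_split_sum => A B; rewrite v0 !scaler0.
apply: comp_eq0; rewrite !raddfD /= !split_sum_linear.
  have z (G : seq homh -> seq homh -> W) : (forall A B, comp1 (G A B) = 0) ->
      split_sum hdeg ts (fun A B => comp1 (G A B)) = 0.
    move=> G0; rewrite -[RHS](split_sum0 hdeg (Lprime g V) ts).
    by apply: eq_split_sum => A B; rewrite G0.
  have c1 t : comp1 (gen_val (inr t)) = 0 by [].
  rewrite !z ?c1 ?addr0// => A B; rewrite linearZ /=.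
    by have [t -> _] := jac_term_LL Q' Q A B; rewrite linearZ /= !scaler0.
  by have [t -> _] := jac_term_LL Q Q' A B; rewrite linearZ /= !scaler0.
have Qg := cochain_homL char0 Q; have Qg' := cochain_homL char0 Q'.
rewrite [comp2 _]etR eR fold_balZ linearZ /= (proj_fold_bal ts Qg Qg').
rewrite [X in _ + X + _](_ : _ = split_sum hdeg ts (fun A B =>
    sg F (odd (homL_deg Q) && ~~ odd (homL_deg Q')) *:
    proj_hh (fold_bal (bal (homL_val Q') (proj_hh (fold_bal (homL_val Q) A)))
      B))); last first.
  apply: eq_split_sum => A B; have [t -> et] := jac_term_LL Q Q' A B.
  rewrite !linearZ /= [comp2 _]et scalerA passE /= odd_pred_int oddD.
  have -> : total_parity gen_deg (map inr A) = odd (tdeg A).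
    by rewrite /total_parity big_map.
  rewrite andb_addl sg_addb mulrC -mulrA -sg_addb [odd (tdeg A) && _]andbC.
  by rewrite addbb mulr1.
rewrite [X in _ + _ + X](_ : _ = split_sum hdeg ts (fun A B =>
    - sg F (odd (homL_deg Q)) *:
    proj_hh (fold_bal (bal (homL_val Q) (proj_hh (fold_bal (homL_val Q') A)))
      B))); last first.
  apply: eq_split_sum => A B; have [t -> et] := jac_term_LL Q' Q A B.
  rewrite !linearZ /= [comp2 _]et scalerA passE /= odd_pred_int oddD.
  rewrite total_parity_cons.
  have -> : total_parity gen_deg (map inr A) = odd (tdeg A).
    by rewrite /total_parity big_map.
  rewrite /= odd_pred_int; congr (_ *: _); rewrite /sg.
  by case: (odd (homL_deg Q)) (odd (homL_deg Q')) (odd (tdeg A)) =>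
    [] [] [] /=; ring.
rewrite -!split_sumZ.
by rewrite /sg; case: (odd (homL_deg Q)) (odd (homL_deg Q')) => [] [] /=; lin F.
Qed.

Lemma jac_gen zs : jacobiator l gen_deg gen_val zs = 0.
Proof.
elim/gen_sort_ind: zs => [u x y v H|Qs ts]; first by rewrite jac_swap H scaler0.
have c := count_inlr Qs ts.
have [e|ne] := boolP ((size Qs == 2) || ((size Qs == 3) && (size ts == 0)))%N.
  case: Qs c e => [|Q1 [|Q2 [|Q3 [|Q4 Qs]]]] //= _; first by rewrite jac_LL.
  by case: ts => // _; apply: jac_LLL.
apply: (@split_sum_eq0 F W gen gen_deg _ isL) => A B cAB sAB;
  apply: jac_term_vanish.
  by rewrite cAB c; apply: contraNneq ne => ->.
rewrite cAB sAB c size_cat !size_map; apply: contra ne; lia.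
Qed.

Lemma jac_hom ds xs : (0 < size xs)%N -> homogeneous_seq (@sLh_hom F g V) ds xs
  ->
  \sum_(1 <= i < (size xs).+1) \sum_(sigma : 'S_(size xs) | shuffle i sigma)
    koszul F ds sigma *:
      l (l (take i (permute sigma xs)) :: drop i (permute sigma xs)) = 0.
Proof.
move=> xs0 /homogeneous_zip[sz H]; rewrite jacobiatorE//.
have jD u d x y v : jacobiator l fst snd (u ++ (d, x + y) :: v) =
    jacobiator l fst snd (u ++ (d, x) :: v) + jacobiator l fst snd (u ++ (d,
      y) :: v).
  apply: split_sum_add => [A1 A2 B|A B1 B2].
    rewrite /nilp !size_cat /= !addnS /= !map_cat /= l_add.
    exact: (l_add [::]).
  case: ifP => _; first by rewrite addr0.
  by rewrite !map_cat /= -!cat_cons l_add.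
apply: (gen_ind (P := fun zs => jacobiator l fst snd zs = 0)) H.
- by move=> u d v; apply: (addrI (jacobiator l fst snd (u ++ (d, 0) :: v)));
    rewrite -jD !addr0.
- by move=> u d x y v hx hy; rewrite jD hx hy addr0.
move=> zs; rewrite /jacobiator split_sum_map -[RHS](jac_gen zs).
apply: eq_split_sum => A B; rewrite /nilp size_map; case: ifP => // _.
by rewrite -!map_comp.
Qed.

End Derived.

(** * Existence of the brackets *)

Section Existence.
Variables (F : fieldType) (char0 : [pchar F] =i pred0) (g V : lmodType F).
Local Notation E := (g * V)%type.
Local Notation W := (sLh g V).
Implicit Types (Q : Lprime g V) (t : hh g V) (ts : seq (hh g V)).

Lemma hh_prop_rescale c (f : seq E -> E) : hh_prop f -> hh_prop (rescale c f).
Proof.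
case=> theta [t0 tm tb ->]; exists (rescale c theta); split.
- by rewrite /rescale t0 scaler0.
- exact: multilinear_rescale.
- exact: bounded_arity_rescale.
- apply/funext => s; rewrite /rescale /ext_V size_map.
  by apply: pair_eqE => //=; rewrite scaler0.
Qed.

Definition Lrescale c Q : Lprime g V :=
  LprimeSub (introT (asboolP _) (Lprime_prop_rescale char0 c (Lprime_valP Q))).

Definition hrescale c t : hh g V :=
  HhSub (introT (asboolP _) (hh_prop_rescale c (hh_valP t))).

Definition degree_indicator (k : int) (n : nat) : F := (n%:Z == k)%:R.

Definition raw1 (w : W) : seq E -> E := w.1.

Lemma raw1_is_linear : linear raw1. Proof. by []. Qed.

HB.instance Definition _ := GRing.isLinear.Build F W (seq E -> E) *:%R raw1
  raw1_is_linear.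

Lemma sLh_grading : is_grading (@sLh_hom F g V).
Proof.
split.
- by move=> i; split.
- by move=> i a x y; apply: sLh_hom_lin.
- case=> Q t; have [Q0 _ [N QN] _ _] := (Lprime_propP char0 _).1 (Lprime_valP
  Q).
  have [t0 _ [M tM] _] := hh_propP (hh_valP t).
  pose c (i : int) : W := (Lrescale (degree_indicator (i + 2)) Q,
                           hrescale (degree_indicator (i + 1)) t).
  (* Index [n] stands for degree [n - 2], which collects arity [n] of [Q] and arity [n - 1] of [t];
     [K] exceeds every index with a nonzero contribution. *)
  pose K := (N + M + 3)%N; pose r := [seq n%:Z - 2 | n <- index_iota 0 K].
  exists r, c; split.
    move=> i; split=> s sN; rewrite /= /rescale /degree_indicator.
      by rewrite (negPf (_ : (size s)%:Z != i + 2)) ?scale0r//;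
        apply: contraNneq sN => ->; lia.
    by rewrite (negPf sN) scale0r.
  have eval (h : {linear W -> (seq E -> E)}) s :
      h (\sum_(i <- r) c i) s = \sum_(n < K) h (c (n%:Z - 2)) s.
    by rewrite linear_sum fct_sumE /= big_map big_mkord.
  have pick (k s : nat) (e : E) : (k <= 2)%N -> ((s + k < K)%N \/ e = 0) ->
      \sum_(n < K) degree_indicator (n%:Z - k%:Z) s *: e = e.
    move=> k2 [sk|->]; last by rewrite big1// => n _; rewrite scaler0.
    rewrite (bigD1 (Ordinal sk))//= big1 ?addr0 => [|n nk].
      by rewrite /degree_indicator PoszD addrK eqxx scale1r.
    rewrite /degree_indicator (_ : (_ == _) = false) ?scale0r//.
    by apply: contraNF nk => /eqP e'; apply/eqP/val_inj => /=; lia.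
  have eqW (x y : W) : raw1 x = raw1 y -> comp2 x = comp2 y -> x = y.
    by case: x y => [x1 x2] [y1 y2] e1 e2; congr (_, _); apply: val_inj.
  apply: eqW; apply/funext => s; rewrite eval.
    rewrite -[LHS](pick 0%N (size s)) ?addn0//; last first.
      by have [/QN|] := ltnP N (size s); [right|left; rewrite /K; lia].
    apply: eq_bigr => n _.
    rewrite -[RHS]/(degree_indicator (n%:Z - 2 + 2) (size s) *: Q s).
    by congr (degree_indicator _ _ *: _); lia.
  rewrite -[LHS](pick 1%N (size s))//; last first.
    by have [/tM|] := ltnP M (size s); [right|left; rewrite /K; lia].
  apply: eq_bigr => n _.
  rewrite -[RHS]/(degree_indicator (n%:Z - 2 + 1) (size s) *: t s).
  by congr (degree_indicator _ _ *: _); lia.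
- move=> s c us hc s0 j js.
  have eval (h : {linear W -> (seq E -> E)}) x k : (forall i,
    has_degree (i + k) (h (c i))) ->
      h (c j) x = 0.
    move=> hk; case: (eqVneq (size x)%:Z (j + k + 1)) => [e|]; last exact: hk.
    have := congr1 (fun w => h w x) s0; rewrite linear0 linear_sum fct_sumE.
    rewrite (bigD1_seq j)//= big1 ?addr0// => i ij; apply: hk.
    by rewrite e; apply: contra ij => /eqP e'; apply/eqP; lia.
  have e1 : raw1 (c j) = 0 by apply/funext => x; apply: (eval _ _ 1) => i;
    case: (hc i).
  have e2 : comp2 (c j) = 0.
    by apply/funext => x; apply: (eval _ _ 0) => i; rewrite addr0; case: (hc i).
  by apply: comp_eq0 => //; apply: val_inj.
Qed.

Lemma hh_multilinear t : multilinear t.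
Proof. by case: (hh_propP (hh_valP t)). Qed.

Lemma Lprime_multilinear Q : multilinear Q.
Proof. by case: ((Lprime_propP char0 _).1 (Lprime_valP Q)). Qed.

(** The counterpart of [fold_bal] for elements that need not be homogeneous, on which the bracket
    must be defined as well. *)
Definition fold_hh (f : seq E -> E) ts :=
  foldl (@bal F E) f (map (@hh_val F g V) ts).

Lemma fold_hh_cat f ts ts' : fold_hh f (ts ++ ts') = fold_hh (fold_hh f ts) ts'.
Proof. by rewrite /fold_hh map_cat foldl_cat. Qed.

Lemma fold_hh_cons f t ts : fold_hh f (t :: ts) = fold_hh (bal f t) ts.
Proof. by []. Qed.

Lemma fold_hh_lin f f' ts a :
  fold_hh (a *: f + f') ts = a *: fold_hh f ts + fold_hh f' ts.
Proof.
elim: ts f f' => //= t ts IH f f'.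
by rewrite {1}/fold_hh /= (bal_linl _ _ _ (hh_multilinear t)); apply: IH.
Qed.

Lemma fold_hh_closed (P : (seq E -> E) -> Prop) f ts :
  (forall f' t, P f' -> P (bal f' t)) -> P f -> P (fold_hh f ts).
Proof. by move=> PS; elim: ts f => //= t ts IH f Pf; apply: IH; apply: PS. Qed.

Lemma fold_hh_multilinear f ts : multilinear f -> multilinear (fold_hh f ts).
Proof.
apply: (fold_hh_closed (P := fun f => multilinear f)) => f' t f'm.
exact: multilinear_bal (hh_multilinear t).
Qed.

Lemma fold_hh_linr f ts1 ts2 a t t' : multilinear f ->
  fold_hh f (ts1 ++ (a *: t + t') :: ts2) =
  a *: fold_hh f (ts1 ++ t :: ts2) + fold_hh f (ts1 ++ t' :: ts2).
Proof.
move=> fm; rewrite !fold_hh_cat !fold_hh_cons -fold_hh_lin.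
by rewrite -[hh_val (a *: t + t')]/(a *: hh_val t + hh_val t') bal_linr//;
  apply: fold_hh_multilinear.
Qed.

Lemma fold_hh_prop Q ts : hh_prop (proj_hh (fold_hh Q ts)).
Proof.
have [] : [/\ fold_hh Q ts [::] = 0, multilinear (fold_hh Q ts) & bounded_arity
  (fold_hh Q ts)].
  apply: (fold_hh_closed (P := fun f => [/\ f [::] = 0,
    multilinear f & bounded_arity f])).
    move=> f' t [f0 fm fb]; have [_ tm tb _] := hh_propP (hh_valP t); split.
    - by rewrite /bal !fctE /insf /= !subr0.
    - exact: multilinear_bal.
    - exact: bounded_arity_bal.
  by have [? ? ? _ _] := (Lprime_propP char0 _).1 (Lprime_valP Q).
by move=> *; apply: hh_prop_proj.
Qed.

(* The value of the bracket on s^{-1}Q, ts. *)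
Definition derived_hh Q ts : hh g V :=
  HhSub (introT (asboolP _) (fold_hh_prop Q ts)).

Lemma derived_hh_linl a Q Q' ts :
  derived_hh (a *: Q + Q') ts = a *: derived_hh Q ts + derived_hh Q' ts.
Proof.
apply: val_inj; rewrite -[LHS]/(proj_hh (fold_hh (a *:
  Lprime_val Q + Lprime_val Q') ts)).
by rewrite fold_hh_lin proj_lin.
Qed.

Lemma derived_hh_linr Q ts1 ts2 a t t' :
  derived_hh Q (ts1 ++ (a *: t + t') :: ts2) =
  a *: derived_hh Q (ts1 ++ t :: ts2) + derived_hh Q (ts1 ++ t' :: ts2).
Proof.
apply: val_inj; rewrite -[LHS]/(proj_hh (fold_hh Q _)).
by rewrite fold_hh_linr ?proj_lin//; apply: Lprime_multilinear.
Qed.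

Lemma derived_hhZ a Q ts : derived_hh (a *: Q) ts = a *: derived_hh Q ts.
Proof.
apply: val_inj; rewrite -[LHS]/(proj_hh (fold_hh (a *: Lprime_val Q) ts)).
have z : fold_hh 0 ts = 0.
  by apply: (addIr (fold_hh 0 ts)); rewrite -{1}[fold_hh 0 ts]scale1r
    -fold_hh_lin scaler0 !add0r.
by rewrite -[a *: _]addr0 fold_hh_lin z addr0 linearZ.
Qed.

Lemma derived_hh0l ts : derived_hh 0 ts = 0.
Proof. by rewrite -(scale0r 0) derived_hhZ scale0r. Qed.

Lemma derived_hh0r Q ts1 ts2 : derived_hh Q (ts1 ++ 0 :: ts2) = 0.
Proof.
apply: (addIr (derived_hh Q (ts1 ++ 0 :: ts2))).
by rewrite -{1}[derived_hh _ _]scale1r -derived_hh_linr scaler0 !add0r.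
Qed.

Lemma derived_hh_scale Q ts1 ts2 a t :
  derived_hh Q (ts1 ++ a *: t :: ts2) = a *: derived_hh Q (ts1 ++ t :: ts2).
Proof. by rewrite -[a *: t]addr0 derived_hh_linr derived_hh0r addr0. Qed.

(** P kills L', so the uniform formula already gives l_1 = 0. *)
Lemma derived_hh_nil Q : derived_hh Q [::] = 0.
Proof.
apply: val_inj; apply/funext => s; apply: pair_eqE => //.
rewrite -[LHS]/(Lprime_val Q (@onV F g V (map snd s))).1.
have [Q0 QM _ QR _] := (Lprime_propP char0 _).1 (Lprime_valP Q).
case: s => [|x s]; first by rewrite /= Q0.
by rewrite (QR.1 _ (0 :: @onV F g V (map snd s))) ?multilinear_cons0.
Qed.

Lemma has_degree_int_parity (p : int) (f : seq E -> E) :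
  has_degree p f -> parity (odd (absz p)) f.
Proof.
move=> fp s sp; apply: fp; apply/eqP => e.
have {e} e : p = (size s)%:Z - 1 by rewrite e addrK.
by move: sp; rewrite e odd_pred_int; case: odd.
Qed.

Lemma even_odd_part (f : seq E -> E) : f = even_part f + odd_part f.
Proof.
apply/funext => s; rewrite /even_part /odd_part /rescale !fctE -scalerDl.
by case: (odd _); rewrite ?addr0 ?add0r scale1r.
Qed.

(** The sign does not involve [f], so the derivation rule, available for maps of one parity, is
    applied to the even and odd parts of [f]. *)
Lemma bal_hh_comm b c (f : seq E -> E) t t' : multilinear f -> parity b t ->
  parity c t' -> bal (bal f t') t = sg F (b && c) *: bal (bal f t) t'.
Proof.
move=> fm tb tc.
have tm := @hh_multilinear t; have tm' := @hh_multilinear t'.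
have main a (f' : seq E -> E) : multilinear f' -> parity a f' ->
    bal (bal f' t') t = sg F (b && c) *: bal (bal f' t) t'.
  move=> f'm f'a; rewrite (bal_leibniz f'm tm' tm f'a tc tb) andbC.
  have -> : bal t' t = 0.
    by rewrite (balE tm' tm tc tb) !insf_hh0 ?scaler0 ?subr0//; apply: hh_valP.
  by rewrite bal0r// add0r.
have em : multilinear (even_part f) by exact: multilinear_rescale.
have om : multilinear (odd_part f) by exact: multilinear_rescale.
rewrite [f]even_odd_part (balDl _ _ tm) (balDl _ _ tm') (balDl _ _ tm) (balDl _
  _ tm').
rewrite scalerDr (main false _ em) ?(main true _ om)//.
- by move=> s sf; rewrite /odd_part /rescale sf scale0r.
- by move=> s sf; rewrite /even_part /rescale sf scale0r.
Qed.

Lemma derived_hh_swap b c Q ts1 ts2 t t' : parity b t -> parity c t' ->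
  derived_hh Q (ts1 ++ t' :: t :: ts2) =
  sg F (b && c) *: derived_hh Q (ts1 ++ t :: t' :: ts2).
Proof.
move=> tb tc; apply: val_inj.
rewrite -[LHS]/(proj_hh (fold_hh Q _)) -[RHS]/(_ *: proj_hh (fold_hh Q _)).
rewrite !fold_hh_cat !fold_hh_cons.
rewrite (bal_hh_comm _ tb tc); last first.
  by apply: fold_hh_multilinear; apply: Lprime_multilinear.
have z : fold_hh 0 ts2 = 0.
  by apply: (addIr (fold_hh 0 ts2)); rewrite -{1}[fold_hh 0 ts2]scale1r
    -fold_hh_lin scaler0 !add0r.
by rewrite -[sg F _ *: _ in LHS]addr0 fold_hh_lin z addr0 linearZ.
Qed.

Definition Leven := Lrescale (fun n => (odd n)%:R).
Definition Lodd := Lrescale (fun n => (~~ odd n)%:R).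
Definition Ltwist := Lrescale (fun n => (-1) ^+ n.+1).
Definition htwist := hrescale (fun n => (-1) ^+ n.+1).

Lemma Lrescale_lin c a Q Q' : Lrescale c (a *: Q + Q') = a *:
  Lrescale c Q + Lrescale c Q'.
Proof. by apply: val_inj; apply: rescale_lin. Qed.

Lemma hrescale_lin c a t t' : hrescale c (a *: t + t') = a *:
  hrescale c t + hrescale c t'.
Proof. by apply: val_inj; apply: rescale_lin. Qed.

(* Each argument of sLh in turn provides the L'-component, which is moved to  *)
(* the front past the hh-components pre of the preceding ones; the sign is    *)
(* trivial when that component has odd degree in L'.                          *)
Fixpoint derived_sum (pre : seq (hh g V)) (xs : seq W) : hh g V :=
  if xs is x :: xs' then
    derived_hh (Lodd x.1) (pre ++ map snd xs') +
    derived_hh (Leven x.1) (map htwist pre ++ map snd xs') +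
    derived_sum (rcons pre x.2) xs'
  else 0.

Definition bal_Lprime Q Q' : Lprime g V :=
  LprimeSub (introT (asboolP _) (Lprime_prop_bal char0 (Lprime_valP Q)
    (Lprime_valP Q'))).

(** Twisting the first argument gives the sign (-1)^|Q| linearly, in all degrees at once. *)
Definition derived_LL_part (xs : seq W) : Lprime g V :=
  if xs is [:: x; y] then bal_Lprime (Ltwist x.1) y.1 else 0.

Definition derived_bracket (xs : seq W) : W :=
  (derived_LL_part xs, derived_sum [::] xs).

Lemma derived_sum_pre_lin pre1 pre2 a t t' xs :
  derived_sum (pre1 ++ (a *: t + t') :: pre2) xs =
  a *: derived_sum (pre1 ++ t :: pre2) xs + derived_sum (pre1 ++ t' :: pre2) xs.
Proof.
elim: xs pre2 => [|x xs IH] pre2 /=; first by rewrite scaler0 addr0.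
rewrite !rcons_cat !rcons_cons IH !map_cat /= -!catA !cat_cons.
by rewrite !derived_hh_linr [htwist (_ + _)]hrescale_lin derived_hh_linr; lin F.
Qed.

Lemma derived_sum_multilinear pre : multilinear (derived_sum pre).
Proof.
move=> u v a x y; elim: u pre => [|z u IH] pre /=.
  rewrite [Lodd (_ + _)]Lrescale_lin [Leven (_ + _)]Lrescale_lin
    !derived_hh_linl -!cats1 derived_sum_pre_lin.
  by lin F.
rewrite IH !map_cat /= !catA !derived_hh_linr.
by lin F.
Qed.

Lemma bal_Lprime_linl a Q1 Q2 Q : bal_Lprime (a *: Q1 + Q2) Q = a *:
  bal_Lprime Q1 Q + bal_Lprime Q2 Q.
Proof. by apply: val_inj; apply: bal_linl; apply: Lprime_multilinear. Qed.

Lemma bal_Lprime_linr a Q1 Q2 Q : bal_Lprime Q (a *: Q1 + Q2) = a *: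
  bal_Lprime Q Q1 + bal_Lprime Q Q2.
Proof. by apply: val_inj; apply: bal_linr; apply: Lprime_multilinear. Qed.

Lemma derived_bracket_multilinear : multilinear derived_bracket.
Proof.
move=> u v a x y; apply/pair_equal_spec; split;
  last exact: derived_sum_multilinear.
rewrite -[RHS]/(a *: derived_LL_part _ + derived_LL_part _).
case: u v => [|z [|z' u]] [|z1 [|z2 v]] //=; rewrite ?scaler0 ?addr0//.
- by rewrite [Ltwist (_ + _)]Lrescale_lin bal_Lprime_linl.
- by rewrite bal_Lprime_linr.
- by case: u => *; rewrite scaler0 addr0.
- by case: u => *; rewrite scaler0 addr0.
- by case: u => *; rewrite scaler0 addr0.
Qed.

Lemma parity_hrescale b c t : parity b t -> parity b (hrescale c t).
Proof. by move=> tb s sb; rewrite /= /rescale tb// scaler0. Qed.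

Lemma derived_sum_pre_swap b c pre1 pre2 t t' xs : parity b t -> parity c t' ->
  derived_sum (pre1 ++ t' :: t :: pre2) xs =
  sg F (b && c) *: derived_sum (pre1 ++ t :: t' :: pre2) xs.
Proof.
move=> tb tc; elim: xs pre2 => [|x xs IH] pre2 /=; first by rewrite scaler0.
rewrite !rcons_cat !rcons_cons IH !map_cat /= -!catA !cat_cons.
rewrite (derived_hh_swap _ _ _ tb tc).
rewrite (derived_hh_swap _ _ _ (parity_hrescale _ tb) (parity_hrescale _ tc)).
by rewrite !scalerDr.
Qed.

Lemma htwist_parity b t : parity b t -> htwist t = sg F b *: t.
Proof. by move=> tb; apply: val_inj; apply: twist_parity. Qed.

Lemma Ltwist_parity b Q : parity b Q -> Ltwist Q = sg F b *: Q.
Proof. by move=> Qb; apply: val_inj; apply: twist_parity. Qed.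

Lemma Leven_parity b Q : parity b Q -> Leven Q = (~~ b)%:R *: Q.
Proof. by move=> Qb; apply: val_inj; apply: even_part_parity. Qed.

Lemma Lodd_parity b Q : parity b Q -> Lodd Q = b%:R *: Q.
Proof. by move=> Qb; apply: val_inj; apply: odd_part_parity. Qed.

Lemma sLh_hom_parity d (x : W) : sLh_hom d x ->
  parity (~~ odd (absz d)) x.1 /\ parity (odd (absz d)) x.2.
Proof.
case=> /has_degree_int_parity x1 /has_degree_int_parity x2; split=> //.
suff <- : odd (absz (d + 1)) = ~~ odd (absz d) by [].
by have := odd_pred_int (absz d); lia.
Qed.

(** If [x] supplies the L'-component, the swap moves that component past the [hh]-component of [y].
    The sign of [y] then appears exactly when [d] is odd, that is, when the component has even
    degree in L'; this is the case that uses [htwist]. *)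
Lemma derived_sum_swap d e pre u x y v : sLh_hom d x -> sLh_hom e y ->
  derived_sum pre (u ++ y :: x :: v) =
  (-1) ^+ absz (d * e) *: derived_sum pre (u ++ x :: y :: v).
Proof.
move=> /sLh_hom_parity[x1 x2] /sLh_hom_parity[y1 y2]; rewrite sign_abszM.
elim: u pre => [|z u IH] pre /=; last first.
  rewrite IH !map_cat /= !catA !(derived_hh_swap _ _ _ x2 y2).
  by rewrite !scalerDr.
rewrite -!cats1 -!catA /= (derived_sum_pre_swap _ _ _ x2 y2) !map_cat -!catA /=.
rewrite (Leven_parity x1) (Leven_parity y1) (Lodd_parity x1) (Lodd_parity y1).
rewrite (htwist_parity x2) (htwist_parity y2) !derived_hhZ !derived_hh_scale.
by rewrite /sg; case: (odd (absz d)) (odd (absz e)) => [] [] /=; lin F.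
Qed.

Lemma bal_Lprime_swap b c Q Q' : parity (~~ b) Q -> parity (~~ c) Q' ->
  bal_Lprime (Ltwist Q') Q = sg F (b && c) *: bal_Lprime (Ltwist Q) Q'.
Proof.
move=> Qb Qc; rewrite (Ltwist_parity Qb) (Ltwist_parity Qc); apply: val_inj.
have QM := @Lprime_multilinear Q; have QM' := @Lprime_multilinear Q'.
rewrite -[LHS]/(bal (sg F (~~ c) *: Lprime_val Q') Q).
rewrite -[RHS]/(sg F (b && c) *: bal (sg F (~~ b) *: Lprime_val Q) Q').
rewrite !balZl// (bal_anti QM' QM Qc Qb) /sg.
by case: b c {Qb Qc} => [] [] /=; lin F.
Qed.

Lemma derived_bracket_symmetric :
  graded_symmetric (@sLh_hom F g V) derived_bracket.
Proof.
apply: swap_symmetric_graded => u [d x] [e y] v /All_cat[_ [/= xd [ye _]]].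
rewrite !map_cat /= /derived_bracket (derived_sum_swap _ _ _ xd ye).
apply/pair_equal_spec; split=> //=.
have [x1 _] := sLh_hom_parity xd; have [y1 _] := sLh_hom_parity ye.
rewrite sign_abszM; case: u v => [|z [|z' u]] [|z1 v] /=; rewrite ?scaler0//.
- exact: bal_Lprime_swap.
- by case: u => *; rewrite scaler0.
- by case: u => *; rewrite scaler0.
Qed.

Lemma bal_Lprime0r Q : bal_Lprime Q 0 = 0.
Proof. by apply: val_inj; apply: bal0r; apply: Lprime_multilinear. Qed.

Lemma Lrescale0 c : Lrescale c 0 = 0.
Proof. by apply: val_inj; apply/funext => s; apply: scaler0. Qed.

Lemma derived_sum_inhh pre ts : derived_sum pre (map (@inhh F g V) ts) = 0.
Proof.
elim: ts pre => //= t ts IH pre.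
by rewrite IH /Lodd /Leven !Lrescale0 !derived_hh0l !addr0.
Qed.

Lemma derived_hh_even_odd Q ts :
  derived_hh (Lodd Q) ts + derived_hh (Leven Q) ts = derived_hh Q ts.
Proof.
rewrite -[derived_hh (Lodd Q) ts]scale1r -derived_hh_linl scale1r;
  congr derived_hh.
by apply: val_inj; rewrite addrC [RHS]even_odd_part.
Qed.

Lemma derived_sum_pre0 pre1 pre2 (zs : seq (Lprime g V + hh g V)) :
  derived_sum (pre1 ++ 0 :: pre2) (map (@insLh F g V) zs) = 0.
Proof.
elim: zs pre2 => //= z zs IH pre2.
rewrite rcons_cat rcons_cons IH !map_cat /= -!catA !cat_cons derived_hh0r.
have -> : htwist 0 = 0 by apply: val_inj; apply/funext => s; apply: scaler0.
by rewrite derived_hh0r !addr0.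
Qed.

Lemma has_inl_zero (zs : seq (Lprime g V + hh g V)) : (0 < count is_inl zs)%N ->
  exists ts1 ts2, map snd (map (@insLh F g V) zs) = ts1 ++ 0 :: ts2.
Proof.
elim: zs => //= -[Q|t] zs IH /= c; first by exists [::],
  (map snd (map (@insLh F g V) zs)).
by have [ts1 [ts2 ->]] := IH c; exists (t :: ts1), ts2.
Qed.

(** With no argument from L' every L'-component is zero. With two or more, whichever supplies the
    component, another one puts a zero among the [hh]-arguments. *)
Lemma derived_sum_vanish pre (zs : seq (Lprime g V + hh g V)) :
  count is_inl zs != 1%N -> derived_sum pre (map (@insLh F g V) zs) = 0.
Proof.
elim: zs pre => //= -[Q|t] zs IH pre /= c; last first.
  by rewrite IH// /Lodd /Leven !Lrescale0 !derived_hh0l !addr0.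
have /has_inl_zero[ts1 [ts2 ->]] : (0 < count is_inl zs)%N by lia.
by rewrite !catA !derived_hh0r -cats1 derived_sum_pre0 !addr0.
Qed.

Lemma homh_list ts : (forall t, t \in ts -> exists d : nat, has_degree d t) ->
  exists us : seq (homh g V), ts = map (@homh_val F g V) us.
Proof.
elim: ts => [|t ts IH] H; first by exists [::].
have [d td] := H t (mem_head _ _).
have [us ->] := IH (fun t' t'ts => H t' (mem_behead (s := t :: ts) t'ts)).
by exists (Homh td :: us).
Qed.

Lemma derived_bracket_brackets : derived_brackets derived_bracket.
Proof.
split.
- exact: derived_bracket_multilinear.
- exact: derived_bracket_symmetric.
- move=> n n' Q Q' Qn Qn'.
  have Qg : cochain n Q by have := cochain_homL char0 (HomL Qn).
  have Qg' : cochain n' Q' by have := cochain_homL char0 (HomL Qn').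
  exists (bal_Lprime (Ltwist Q) Q').
    rewrite (balavoineE (cochainM Qg) (cochainM Qg') (cochainP Qg) (cochainP
      Qg')).
    rewrite (Ltwist_parity (cochainP Qg)) -[LHS]/(bal (sg F (odd n) *:
      Lprime_val Q) Q').
    by rewrite balZl ?/sg ?signr_odd//; apply: cochainM Qg'.
  apply/pair_equal_spec; split=> //.
  exact: (derived_sum_vanish [::] (zs := [:: inl Q; inl Q'])).
- move=> n Q ts Qn ts0 tsd; have [us e] := homh_list tsd.
  have Qg : cochain n Q by have := cochain_homL char0 (HomL Qn).
  exists (derived_hh Q ts).
    rewrite e (foldl_balavoine _ Qg).
    rewrite -[LHS]/(proj_hh (fold_hh Q (map (@homh_val F g V) us))).
    by rewrite /fold_hh -map_comp.
  apply/pair_equal_spec; split.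
    case: ts {e ts0 tsd us} => [|t [|t' ts]] //; exact: bal_Lprime0r.
  rewrite -[LHS]/(derived_hh (Lodd Q) (map snd (map (@inhh F g V) ts)) +
    derived_hh (Leven Q) (map snd (map (@inhh F g V) ts)) +
    derived_sum [:: 0] (map (@inhh F g V) ts)).
  rewrite derived_sum_inhh addr0 derived_hh_even_odd; congr derived_hh.
  by rewrite -map_comp map_id.
- move=> zs m m1 m2; apply/pair_equal_spec; split.
    case: zs @m m1 m2 => [|[Q|t] [|[Q'|t'] [|z zs]]] //= _ _.
    exact: bal_Lprime0r.
  case: (eqVneq (count is_inl zs) 1%N) => [e|]; last exact: derived_sum_vanish.
  case: zs @m m1 m2 e => [|z [|z' zs]] //= m1 _ e;
    first by rewrite !derived_hh_nil !addr0.
  by move: m1; rewrite e.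
Qed.

End Existence.

Theorem proposition4p8 (F : fieldType) (char0 : [pchar F] =i pred0)
    (g V : lmodType F) :
  (exists l : seq (sLh g V) -> sLh g V, derived_brackets l) /\
  (forall l : seq (sLh g V) -> sLh g V,
     derived_brackets l -> Linfty_algebra (@sLh_hom F g V) l).
Proof.
split; first by exists (derived_bracket char0 (V := V));
  apply: derived_bracket_brackets.
move=> l lD; split.
- exact: sLh_grading.
- exact: derived_multilinear.
- exact: derived_symmetric.
- by move=> ds xs _; apply: l_degree.
- by move=> ds xs; apply: jac_hom.
Qed.
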